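(* Let $\{p,q\}$ be the Schläfli symbol of a Platonic solid, let $\omega_n:=1+2\cos\frac{2\pi}{n}$, and let $b_1,b_2,b_3$ be three consecutive entries of a fundamental bend vector of the Platonic crystallographic packing $\mathscr P_{\{p,q\}}(b_1,b_2,b_3)$. Put $$\Delta_{\{p,q\}}:=(1+\omega_q)(b_1b_2+b_2b_3+b_3b_1-\omega_p b_2^2).$$ If $b_1,b_2,b_3$ and $\sqrt{\Delta_{\{p,q\}}}$ belong to $\mathbb Z[\omega_p,\omega_q]$, then $\mathscr P_{\{p,q\}}(b_1,b_2,b_3)$ is $\mathbb Z[\omega_p,\omega_q]$-integral, i.e. the bends of all its circles belong to $\mathbb Z[\omega_p,\omega_q]$.
   Context: Circles of $\widehat{\mathbb R^2}=\mathbb R^2\cup\{\infty\}$ are oriented (disk, exterior of a disk, or half-plane); the bend is the reciprocal of the signed radius ($0$ for a half-plane). For $v\in\mathbb R^3$ with $\|v\|>1$, the stereographic circle of $v$ is the image under stereographic projection (from the North Pole) of the cap $\{u\in\mathbb S^2:u\cdot v\ge1\}$. The Platonic solid $\mathcal P=\{p,q\}$ has $p$-gonal faces, $q$ of which meet at each vertex. Let $\mathcal P_0$ be its canonical realisation (regular polyhedron centred at the origin, all edges tangent to $\mathbb S^2$) and $\mathcal P_0^*=\{u:u\cdot v\le1\ \forall v\in\mathcal P_0\}$ its polar. A polytopal circle packing induced by $\mathcal P$ is $\mathcal S_{\mathcal P}=\mu\cdot\mathcal A_{\mathcal P_0}$, with dual arrangement $\mathcal S_{\mathcal P}^*=\mu\cdot\mathcal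 A_{\mathcal P_0^*}$, where $\mu$ is a Möbius transformation (possibly orientation-reversing) and $\mathcal A_{\mathcal P_0},\mathcal A_{\mathcal P_0^*}$ are the collections of stereographic circles of the vertices of $\mathcal P_0,\mathcal P_0^*$. For a vertex $v$, $S_v\in\mathcal S_{\mathcal P}$ is the corresponding circle. Given a flag $\Phi=(f_0,f_1,f_2,f_3=\mathcal P)$ (vertex $\subset$ edge $\subset$ face $\subset\mathcal P$), let $r_i$ ($i=1,2,3$) be the reflection symmetry of $\mathcal P$ fixing every element of $\Phi$ except $f_{i-1}$. The fundamental basis with respect to $\Phi$ is $(v_1,v_2,v_3,v_4)$ with $v_1=f_0$, $v_2=r_1(v_1)$, $v_3=r_1r_2(v_2)$, $v_4=r_1r_2r_3(v_3)$. A fundamental bend vector of $\mathcal S_{\mathcal P}$ is the vector of bends of $S_{v_1},S_{v_2},S_{v_3},S_{v_4}$ for some flag. The Platonic crystallographic packing of $\mathcal S_{\mathcal P}$ is the Apollonian arrangement $\mathscr P(\mathcal S_{\mathcal P})=\langle\mathcal S_{\mathcal P}^*\rangle\cdot\mathcal S_{\mathcal P}$, the union of the orbits of the circles of $\mathcal S_{\mathcal P}$ under the group $\langle\mathcal S_{\mathcal P}^*\rangle$ generated by the inversions through the circles of $\mathcal S_{\mathcal P}^*$. $\mathscr P_{\{p,q\}}(b_1,b_2,b_3)$ denotes the Platonic crystallographic packing $\mathscr P(\mathcal S_{\mathcal P})$ with $\mathcal P=\{p,q\}$ in which $b_1,b_2,b_3$ are three consecutive entries of a fundamental bend vector of $\mathcal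 S_{\mathcal P}$ (its set of bends is fully determined by $b_1,b_2,b_3$). *)

(* Defs.v *)
From HB Require Import structures.
From mathcomp Require Import all_boot all_order all_algebra.
From mathcomp Require Import all_classical all_reals all_analysis.
Set Implicit Arguments.
Unset Strict Implicit.
Unset Printing Implicit Defensive.
Import Order.TTheory GRing.Theory Num.Theory.
Local Open Scope classical_set_scope.
Local Open Scope ring_scope.

Section Definitions.
Variable R : realType.

Definition dot (n : nat) (u v : 'rV[R]_n) : R := \sum_i u 0 i * v 0 i.

(* [None] is the point at infinity. *)
Definition extended_plane : Type := option 'rV[R]_2.

(* [Round c r] has centre [c] and signed radius [r], negative for the exterior
   of a disk; [Line n d] bounds the half-plane [dot n x >= d]. As [n] is a unit
   normal, the data are determined by the [region] below. *)
Inductive ocircle : Type :=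
| Round (c : 'rV[R]_2) (r : R) of r != 0
| Line (n : 'rV[R]_2) (d : R) of dot n n = 1.

Definition region (C : ocircle) : set extended_plane :=
  match C with
  | Round c r _ => fun x =>
      if x is Some y
      then if 0 < r then dot (y - c) (y - c) <= r ^+ 2
           else r ^+ 2 <= dot (y - c) (y - c)
      else r < 0
  | Line n d _ => fun x => if x is Some y then d <= dot n y else true
  end.

Definition bend (C : ocircle) : R := if C is Round _ r _ then r^-1 else 0.

Definition circle_inversion (C : ocircle) (x : extended_plane) :
    extended_plane :=
  match C, x with
  | Round c r _, None => Some c
  | Round c r _, Some y =>
      if y == c then None
      else Some (c + (r ^+ 2 / dot (y - c) (y - c)) *: (y - c))
  | Line n d _, None => None
  | Line n d _, Some y => Some (y - (2 * (dot n y - d)) *: n)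
  end.

(* Since inversions are involutions, closing under composition with them
   yields the group that they generate. *)
Inductive inversion_group (A : set (set extended_plane)) :
    (extended_plane -> extended_plane) -> Prop :=
| inversion_group_id : inversion_group A id
| inversion_group_comp (C : ocircle) (f : extended_plane -> extended_plane) :
    A (region C) -> inversion_group A f ->
    inversion_group A (circle_inversion C \o f).

(* Orientation-preserving and orientation-reversing. *)
Definition moebius : (extended_plane -> extended_plane) -> Prop :=
  inversion_group setT.

Definition sphere : set 'rV[R]_3 := [set u | dot u u = 1].

(* From the pole (0, 0, 1) to the equatorial plane. *)
Definition stereographic (u : 'rV[R]_3) : extended_plane :=
  if u 0 ord_max == 1 then None
  else Some (\row_(j < 2) (u 0 (lift ord_max j) / (1 - u 0 ord_max))).

Definition stereographic_circle (v : 'rV[R]_3) : set extended_plane :=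
  stereographic @` [set u | sphere u /\ 1 <= dot u v].

Definition polytope (P : set 'rV[R]_3) : Prop :=
  exists (m : nat) (A : 'M[R]_(m, 3)),
    P = [set x | exists w : 'rV[R]_m,
          [/\ forall i, 0 <= w 0 i, \sum_i w 0 i = 1 & x = w *m A]].

(* Nonempty faces, [P] itself included. *)
Definition face (P F : set 'rV[R]_3) : Prop :=
  F !=set0 /\ exists (a : 'rV[R]_3) (c : R),
    (forall x, P x -> dot a x <= c) /\ F = [set x | P x /\ dot a x = c].

(* [x0] and the [x0 + row i A] are [k + 1] affinely independent points of [F],
   whose affine hull contains [F]. *)
Definition affine_dim (F : set 'rV[R]_3) (k : nat) : Prop :=
  exists (x0 : 'rV[R]_3) (A : 'M[R]_(k, 3)),
    [/\ F x0, row_free A, forall i, F (x0 + row i A)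
      & forall x, F x -> (x - x0 <= A)%MS].

Definition face_of_dim (P : set 'rV[R]_3) (k : nat) (F : set 'rV[R]_3) : Prop :=
  face P F /\ affine_dim F k.

Definition vertex (P : set 'rV[R]_3) (v : 'rV[R]_3) : Prop :=
  face_of_dim P 0 [set v].

Definition flag (P : set 'rV[R]_3) (f : 'I_4 -> set 'rV[R]_3) : Prop :=
  [/\ f ord_max = P, forall i : 'I_4, face_of_dim P i (f i)
    & forall i j : 'I_4, (i <= j)%N -> f i `<=` f j].

(* Regularity of a polyhedron centred at the origin: its symmetries fix the
   centre, hence are the linear isometries preserving it, here acting on row
   vectors; they must be transitive on flags. *)
Definition regular (P : set 'rV[R]_3) : Prop :=
  forall f g : 'I_4 -> set 'rV[R]_3, flag P f -> flag P g ->
    exists2 Q : 'M[R]_3, Q *m Q^T = 1%:M &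
      forall i, (fun x => x *m Q) @` f i = g i.

Definition platonic_solid (p q : nat) (P : set 'rV[R]_3) : Prop :=
  [/\ polytope P, affine_dim P 3, regular P,
      forall F, face_of_dim P 2 F -> ([set v | vertex P v /\ F v] #= `I_p)%card
    & forall v, vertex P v -> ([set F | face_of_dim P 2 F /\ F v] #= `I_q)%card].

(* [E] touches the unit sphere at [x] and lies in its tangent plane there. *)
Definition tangent_to_sphere (E : set 'rV[R]_3) : Prop :=
  exists x, [/\ E x, sphere x & forall y, E y -> dot x y = 1].

Definition canonical_platonic_solid (p q : nat) (P : set 'rV[R]_3) : Prop :=
  platonic_solid p q P /\ forall E, face_of_dim P 1 E -> tangent_to_sphere E.

Definition polar (P : set 'rV[R]_3) : set 'rV[R]_3 :=
  [set u | forall v, P v -> dot u v <= 1].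

Definition reflection (n x : 'rV[R]_3) : 'rV[R]_3 :=
  x - (2 * dot n x / dot n n) *: n.

(* [r] is [r_i], for [i = 1, 2, 3]: it fixes every element of the flag (which
   includes the polyhedron itself) except [f_(i-1)]. *)
Definition flag_reflection (f : 'I_4 -> set 'rV[R]_3) (i : nat)
    (r : 'rV[R]_3 -> 'rV[R]_3) : Prop :=
  (exists2 n, n != 0 & r = reflection n) /\
  forall k : 'I_4, r @` f k = f k <-> k.+1 <> i.

Definition fundamental_basis (P : set 'rV[R]_3) (v1 v2 v3 v4 : 'rV[R]_3) :
    Prop :=
  exists (f : 'I_4 -> set 'rV[R]_3) (r1 r2 r3 : 'rV[R]_3 -> 'rV[R]_3),
    [/\ flag P f, flag_reflection f 1 r1, flag_reflection f 2 r2,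
        flag_reflection f 3 r3
      & [/\ f ord0 = [set v1], v2 = r1 v1, v3 = r1 (r2 v2)
          & v4 = r1 (r2 (r3 v3))]].

Definition arrangement (mu : extended_plane -> extended_plane)
    (P : set 'rV[R]_3) : set (set extended_plane) :=
  [set mu @` stereographic_circle v | v in vertex P].

Definition fundamental_bend_vector (mu : extended_plane -> extended_plane)
    (P : set 'rV[R]_3) (b : seq R) : Prop :=
  exists (v1 v2 v3 v4 : 'rV[R]_3) (C1 C2 C3 C4 : ocircle),
    [/\ fundamental_basis P v1 v2 v3 v4,
        region C1 = mu @` stereographic_circle v1,
        region C2 = mu @` stereographic_circle v2,
        region C3 = mu @` stereographic_circle v3
      & region C4 = mu @` stereographic_circle v4 /\
        b = [:: bend C1; bend C2; bend C3; bend C4]].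

Definition crystallographic_packing (mu : extended_plane -> extended_plane)
    (P : set 'rV[R]_3) : set (set extended_plane) :=
  [set D | exists g S,
    [/\ inversion_group (arrangement mu (polar P)) g, arrangement mu P S
      & D = g @` S]].

Definition omega (n : nat) : R := 1 + 2 * cos (2 * pi / n%:R).

(* [Z[a, b]], the smallest subring containing [a] and [b]. *)
Definition int_adjoin (a b : R) : set R :=
  [set x | forall S : {pred R},
    subring_closed S -> a \in S -> b \in S -> x \in S].

Definition integral_arrangement (Z : set R) (A : set (set extended_plane)) :
    Prop :=
  forall D, A D -> exists2 C : ocircle, region C = D & Z (bend C).

End Definitions.

Arguments omega : clear implicits.

(* Main.v *)
Require Import Defs.
From HB Require Import structures.
From mathcomp Require Import all_boot all_order all_algebra.
From mathcomp Require Import all_classical all_reals all_analysis.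
From mathcomp Require Import ring lra.
Set Implicit Arguments.
Unset Strict Implicit.
Unset Printing Implicit Defensive.
Import Order.TTheory GRing.Theory Num.Theory.
Local Open Scope classical_set_scope.
Local Open Scope ring_scope.

(** The group of the packing is transported to Minkowski space. A cap of the
    sphere cut by [1 <= dot _ v] is represented by the vector [(v, 1)] of signature
    (3,1), a Moebius transformation acts as a linear isometry, an inversion as a
    Lorentz reflection, and the bend is a linear functional, namely the pairing
    with a light-like vector that represents the point at infinity
    ([inversion_point_vec], [moebius_isometry]). A region determines its unit
    vector ([region_of_inj]), so everything can be computed with vectors.

    Let [v1], ..., [v4] be the fundamental basis, [x] and [y] the numbers
    [omega p] and [omega q], and [Z] the ring that they generate. The proof shows
    that the [Z]-lattice spanned by the four vectors [(vi, 1)] contains the vector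
    of every vertex and is stable under the reflections in the vectors of all
    polar vertices ([lattice_vertex], [lattice_face]). All bends are then
    [Z]-combinations of the four fundamental bends. As the bend functional is
    light-like, three consecutive fundamental bends determine the remaining one by
    a quadratic equation over [Z] whose discriminant is, up to a square, the
    number [Delta] ([last_value_sqr], [first_value_sqr]); so the fourth bend lies
    in [Z] as soon as [Num.sqrt Delta] does.

    The geometry of the polyhedron enters through one frame per flag: the vertex
    [v], the midpoint [e] of the edge, which lies on the unit sphere, and the
    normal [f] of the face, scaled so that the face lies in the plane
    [dot f _ = 1]. Then [e], [v - e] and [f - e] are orthogonal, [v - e] and
    [f - e] are normals of the first and the third reflection of the flag, and
    every identity reduces to a computation with the two numbers [dot v v] and
    [dot f f]. Exchanging [v] with [f] is polar duality, so each geometric fact is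
    proved once and used for vertices and for faces.

    Two facts are not computations. First, the reflections of one flag already
    move its vertex to all vertices and its face to all faces
    ([max_in_orbit_f], [exposed_in_orbit]): any functional can be moved into the
    chamber of the flag, the cone on [v], [e] and [f], and there its maximum on
    the polyhedron is attained at [v], and its maximum on the polar at [f].
    Secondly, the angles of the frame are those announced by the Schlaefli symbol
    ([weight_of_count]): the vertices of a face form the orbit of [v] under a
    rotation, no vertex lies between [v] and its neighbour because [e] supports
    the edge, and the number of vertices is [p]; dually for [q]. *)

(** * Dot products *)

Section DotProduct.
Variables (R : realType) (n : nat).
Implicit Types (u v w : 'rV[R]_n) (a : R).

Lemma dotC u v : dot u v = dot v u.
Proof. by apply: eq_bigr => i _; rewrite mulrC. Qed.

Lemma dotDl u v w : dot (u + v) w = dot u w + dot v w.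
Proof. by rewrite -big_split; apply: eq_bigr => i _; rewrite mxE mulrDl. Qed.

Lemma dotZl a u v : dot (a *: u) v = a * dot u v.
Proof. by rewrite big_distrr; apply: eq_bigr => i _; rewrite mxE /= mulrA. Qed.

Lemma dotDr u v w : dot u (v + w) = dot u v + dot u w.
Proof. by rewrite !(dotC u) dotDl. Qed.

Lemma dotZr a u v : dot u (a *: v) = a * dot u v.
Proof. by rewrite !(dotC u) dotZl. Qed.

Lemma dotNl u v : dot (- u) v = - dot u v.
Proof. by rewrite -scaleN1r dotZl mulN1r. Qed.

Lemma dotNr u v : dot u (- v) = - dot u v.
Proof. by rewrite !(dotC u) dotNl. Qed.

Lemma dot0l u : dot 0 u = 0.
Proof. by rewrite -(scale0r u) dotZl mul0r. Qed.

Lemma dot0r u : dot u 0 = 0.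
Proof. by rewrite dotC dot0l. Qed.

Lemma dot_ge0 u : 0 <= dot u u.
Proof. by apply: sumr_ge0 => i _; rewrite -expr2 sqr_ge0. Qed.

Lemma dot_eq0 u : (dot u u == 0) = (u == 0).
Proof.
apply/eqP/eqP => [h|->]; last exact: dot0l.
apply/rowP => i; rewrite mxE; apply/eqP.
have /eqP := h; rewrite psumr_eq0; last first.
  by move=> j _; rewrite -expr2 sqr_ge0.
by move/allP/(_ i); rewrite mem_index_enum mulf_eq0 orbb; exact.
Qed.

Lemma dot_gt0 u : (0 < dot u u) = (u != 0).
Proof. by rewrite lt_def dot_ge0 andbT dot_eq0. Qed.

Definition dotE := (dotDl, dotDr, dotNl, dotNr, dotZl, dotZr).

Lemma dot_mulmx_tr u v : dot u v = (u *m v^T) 0 0.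
Proof. by rewrite mxE; apply: eq_bigr => i _; rewrite !mxE. Qed.

(** The case of equality in the Cauchy-Schwarz inequality. *)
Lemma dot_max_eq u v : dot v v <= dot v u -> dot u u <= dot v u -> v = u.
Proof.
move=> h1 h2; apply/eqP; rewrite -subr_eq0 -dot_eq0 eq_le dot_ge0 andbT.
rewrite !dotE (dotC u v); lra.
Qed.

End DotProduct.

(** * Reflections and the groups they generate *)

Section Reflections.
Variable R : realType.
Implicit Types (n u v x y : 'rV[R]_3).

Lemma reflectionD n x y : reflection n (x + y) = reflection n x + reflection n y.
Proof.
rewrite /reflection dotDr; apply/rowP => i; rewrite !mxE.
by rewrite mulrDr mulrDl mulrDl; ring.
Qed.

Lemma reflectionZ n a x : reflection n (a *: x) = a *: reflection n x.
Proof. by rewrite /reflection dotZr; apply/rowP => i; rewrite !mxE; ring. Qed.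

Lemma reflectionN n x : reflection n (- x) = - reflection n x.
Proof. by rewrite -scaleN1r reflectionZ scaleN1r. Qed.

Definition reflectionE := (reflectionD, reflectionN, reflectionZ).

Lemma reflection_fix n x : dot n x = 0 -> reflection n x = x.
Proof. by rewrite /reflection => ->; rewrite mulr0 mul0r scale0r subr0. Qed.

Lemma reflection_fixP n x : n != 0 -> reflection n x = x -> dot n x = 0.
Proof.
move=> n0 /eqP; rewrite /reflection -subr_eq0 addrAC subrr add0r oppr_eq0.
rewrite scaler_eq0 (negPf n0) orbF !mulf_eq0 invr_eq0 dot_eq0 (negPf n0) orbF.
by rewrite pnatr_eq0 => /eqP.
Qed.

Lemma dot_reflectionl n x y : dot (reflection n x) y = dot x (reflection n y).
Proof. by rewrite /reflection !dotE (dotC x n); ring. Qed.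

Lemma reflectionK n : involutive (reflection n).
Proof.
move=> x; have [->|n0] := eqVneq n 0; first by rewrite /reflection !scaler0 !subr0.
have d0 : dot n n != 0 by rewrite dot_eq0.
rewrite /reflection !dotE; apply/rowP => i; rewrite !mxE; field.
exact: d0.
Qed.

Lemma reflection_isom n x y :
  dot (reflection n x) (reflection n y) = dot x y.
Proof. by rewrite dot_reflectionl reflectionK. Qed.

Lemma reflection_scale n a : a != 0 -> reflection (a *: n) = reflection n.
Proof.
move=> a0; apply: funext => x; rewrite /reflection !dotE scalerA.
have [->|n0] := eqVneq n 0; first by rewrite !scaler0.
have d0 : dot n n != 0 by rewrite dot_eq0.
by congr (_ - _ *: _); field; rewrite d0 a0.
Qed.

Lemma reflection_preserves n (A : set 'rV[R]_3) x :
  reflection n @` A = A -> A x -> A (reflection n x).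
Proof. by move=> h; rewrite -{1}h => -[y Ay <-]; rewrite reflectionK. Qed.

Lemma reflection_preservesP n (A : set 'rV[R]_3) :
  (forall x, A x -> A (reflection n x)) -> reflection n @` A = A.
Proof.
move=> h; apply/seteqP; split => [y [x Ax <-]|x Ax]; first exact: h.
by exists (reflection n x); [exact: h|rewrite reflectionK].
Qed.

(** The normals in [N] generate the group; closing under left composition is
    enough because reflections are involutions. *)
Inductive reflection_group (N : set 'rV[R]_3) :
    ('rV[R]_3 -> 'rV[R]_3) -> Prop :=
| reflection_group_id : reflection_group N id
| reflection_group_comp n h : N n -> reflection_group N h ->
    reflection_group N (reflection n \o h).

Lemma reflection_group_mul N g h :
  reflection_group N g -> reflection_group N h -> reflection_group N (g \o h).
Proof.
move=> Gg Gh; elim: Gg => [//|n g' Nn _ IH].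
by have := reflection_group_comp Nn IH.
Qed.

Lemma reflection_group1 N n : N n -> reflection_group N (reflection n).
Proof. by move=> Nn; exact: (reflection_group_comp Nn (reflection_group_id N)). Qed.

Lemma reflection_groupS N N' h :
  N `<=` N' -> reflection_group N h -> reflection_group N' h.
Proof.
move=> NN'; elim => [|n g Nn _ IH]; first exact: reflection_group_id.
by apply: reflection_group_comp => //; exact: NN'.
Qed.

Lemma reflection_group_adjoint N h : reflection_group N h ->
  exists2 h', reflection_group N h' &
    [/\ cancel h h', cancel h' h & forall x y, dot (h x) y = dot x (h' y)].
Proof.
elim => [|n g Nn Gg [g' Gg' [gK g'K adj]]].
  by exists id => //; exact: reflection_group_id.
exists (g' \o reflection n).
  by apply: reflection_group_mul => //; exact: reflection_group1.
split => [x|x|x y] /=; first by rewrite reflectionK gK.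
  by rewrite g'K reflectionK.
by rewrite dot_reflectionl adj.
Qed.

Lemma reflection_group_isom N h : reflection_group N h ->
  forall x y, dot (h x) (h y) = dot x y.
Proof. by move=> /reflection_group_adjoint[h' _ [hK _ adj]] x y; rewrite adj hK. Qed.

Lemma reflection_group_lin N h : reflection_group N h ->
  forall a x y, h (a *: x + y) = a *: h x + h y.
Proof. by elim => // n g _ _ IH a x y /=; rewrite IH !reflectionE. Qed.

Lemma reflection_groupD N h : reflection_group N h ->
  forall x y, h (x + y) = h x + h y.
Proof. by move=> H x y; rewrite -(scale1r x) (reflection_group_lin H) !scale1r. Qed.

Lemma reflection_groupZ N h : reflection_group N h ->
  forall a x, h (a *: x) = a *: h x.
Proof.
move=> H a x; have h0 : h 0 = 0.
  apply: (addIr (h 0)); by rewrite -(reflection_groupD H) add0r add0r.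
by rewrite -[a *: x]addr0 (reflection_group_lin H) h0 addr0.
Qed.

Lemma reflection_group_stable N (A : set 'rV[R]_3) h :
  (forall n x, N n -> A x -> A (reflection n x)) ->
  reflection_group N h -> forall x, A x -> A (h x).
Proof. by move=> st; elim => // n g Nn _ IH x Ax /=; apply/st/IH. Qed.

Lemma finite_set_max (S : set R) :
  finite_set S -> S !=set0 -> exists2 m, S m & forall x : R, S x -> x <= m.
Proof.
move=> /finite_seqP[s ->]; elim: s => [|a s IH] [x0 /= hx0].
  by rewrite in_nil in hx0.
have [->|s0] := eqVneq s [::].
  exists a => /= [|x]; first by rewrite mem_head.
  by rewrite inE => /eqP->.
case: IH => [|m ms mmax].
  by case: s s0 {hx0} => // b s _; exists b; rewrite /= mem_head.
exists (Num.max a m) => /= [|x].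
  rewrite inE /Num.max; case: ifP => _; first by rewrite [m \in s]ms orbT.
  by rewrite eqxx.
rewrite inE => /orP[/eqP->|/mmax xm]; rewrite le_max ?lexx //.
by rewrite xm orbT.
Qed.

(** The element of the group that brings [a] closest to [c] brings it into the
    chamber of [c]: a mirror separating the two could be used to bring them
    closer. *)
Lemma move_to_chamber (N : set 'rV[R]_3) (c : 'rV[R]_3) :
  finite_set [set h c | h in reflection_group N] ->
  (forall n, N n -> 0 < dot n c) ->
  forall a, exists2 h, reflection_group N h &
    forall n, N n -> 0 <= dot n (h a).
Proof.
move=> fin pos a.
have [|_ [_ [h Gh <-] <-] hmax] :=
    finite_set_max (finite_image (dot a) fin).
  by exists (dot a c), c => //; exists id => //; exact: reflection_group_id.
have [h' Gh' [hK h'K adj]] := reflection_group_adjoint Gh.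
exists h' => // n Nn; rewrite leNgt; apply/negP => neg.
have : dot a (h (reflection n c)) <= dot a (h c).
  apply: hmax; exists (h (reflection n c)) => //; exists (h \o reflection n) => //.
  by apply: reflection_group_mul => //; exact: reflection_group1.
rewrite !(dotC a) !adj {1}/reflection !dotE (dotC c).
have n0 : 0 < dot n n.
  by rewrite dot_gt0; apply/eqP => n0; move: neg; rewrite n0 dot0l ltxx.
suff : 0 < - (2 * dot n c / dot n n * dot n (h' a)) by lra.
by rewrite -mulrN !mulr_gt0 ?invr_gt0 ?oppr_gt0 ?pos.
Qed.

End Reflections.

(** * The frame of a flag *)

Section Frames.
Variable R : realType.
Implicit Types (v e f d x y : 'rV[R]_3).

(** The vertex [v], the midpoint [e] of an edge, where it touches the sphere, and
    the normal [f] of a face, scaled so that the face lies on [dot f _ = 1]; thus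
    [f] is a vertex of the polar polyhedron. *)
Record frame v e f : Prop := Frame {
  frame_ee : dot e e = 1;
  frame_ve : dot v e = 1;
  frame_fe : dot f e = 1;
  frame_vf : dot v f = 1;
  frame_vv : 1 < dot v v;
  frame_ff : 1 < dot f f }.

Lemma frame_dual v e f : frame v e f -> frame f e v.
Proof. by case=> ee ve fe vf vv ff; split=> //; rewrite dotC. Qed.

Definition gram v e f (F : frame v e f) :=
  (frame_ee F, frame_ve F, frame_fe F, frame_vf F,
   etrans (dotC e v) (frame_ve F), etrans (dotC e f) (frame_fe F),
   etrans (dotC f v) (frame_vf F)).

Lemma frame_ext v e f d : frame v e f ->
  dot d v = 0 -> dot d e = 0 -> dot d f = 0 -> d = 0.
Proof.
move=> [ee ve fe vf vv ff] dv de df.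
have dot3 (a b : 'rV[R]_3) : dot a b = a 0 0 * b 0 0 + a 0 1 * b 0 1 + a 0 2 * b 0 2 :> R.
  rewrite /dot !big_ord_recl. rewrite big_ord0 addr0 addrA.
  by congr (_ * _ + _ * _ + _ * _); congr (_ 0 _); apply: val_inj.
pose det := v 0 0 * (e 0 1 * f 0 2 - e 0 2 * f 0 1)
          + v 0 1 * (e 0 2 * f 0 0 - e 0 0 * f 0 2)
          + v 0 2 * (e 0 0 * f 0 1 - e 0 1 * f 0 0) : R.
have gram : det ^+ 2 = (dot v v - 1) * (dot f f - 1).
  transitivity (dot v v * (dot e e * dot f f - dot f e ^+ 2)
    - dot v e * (dot v e * dot f f - dot f e * dot v f)
    + dot v f * (dot v e * dot f e - dot e e * dot v f)).
    by rewrite /det !dot3; ring.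
  by rewrite ee ve fe vf; ring.
have det0 : det != 0.
  rewrite -sqrf_eq0 gram mulf_neq0 // subr_eq0 gt_eqF //.
have c0 : det * d 0 0 = 0.
  transitivity (dot d v * (e 0 1 * f 0 2 - e 0 2 * f 0 1)
              + dot d e * (f 0 1 * v 0 2 - f 0 2 * v 0 1)
              + dot d f * (v 0 1 * e 0 2 - v 0 2 * e 0 1)).
    by rewrite /det !dot3; ring.
  by rewrite dv de df !mul0r !addr0.
have c1 : det * d 0 1 = 0.
  transitivity (dot d v * (e 0 2 * f 0 0 - e 0 0 * f 0 2)
              + dot d e * (f 0 2 * v 0 0 - f 0 0 * v 0 2)
              + dot d f * (v 0 2 * e 0 0 - v 0 0 * e 0 2)).
    by rewrite /det !dot3; ring.
  by rewrite dv de df !mul0r !addr0.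
have c2 : det * d 0 2 = 0.
  transitivity (dot d v * (e 0 0 * f 0 1 - e 0 1 * f 0 0)
              + dot d e * (f 0 0 * v 0 1 - f 0 1 * v 0 0)
              + dot d f * (v 0 0 * e 0 1 - v 0 1 * e 0 0)).
    by rewrite /det !dot3; ring.
  by rewrite dv de df !mul0r !addr0.
apply: (@scalerI _ _ det) => //; rewrite scaler0; apply/rowP => i; rewrite !mxE.
have : i \in [:: 0; 1; 2] by case: i => [[|[|[|]]]].
by rewrite !inE => /or3P[] /eqP->.
Qed.

(** [weight v f] and [weight f v] are the coordinates on [v] and [f] of the
    orthogonal projection of [e] on the plane spanned by [v] and [f]. *)
Definition weight v f : R := (dot f f - 1) / (dot v v * dot f f - 1).

(** The normal of the reflection that fixes [v] and [f]. *)
Definition mirror v e f := e - weight v f *: v - weight f v *: f.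

Lemma mirror_dual v e f : mirror v e f = mirror f e v.
Proof. by rewrite /mirror addrAC. Qed.

Lemma frame_den v e f : frame v e f -> 0 < dot v v * dot f f - 1.
Proof. by move=> [_ _ _ _ vv ff]; nra. Qed.

Lemma weight_gt0 v e f : frame v e f -> 0 < weight v f.
Proof.
move=> F; rewrite /weight divr_gt0 ?(frame_den F) //.
by rewrite subr_gt0 (frame_ff F).
Qed.

Lemma weightD v e f : frame v e f -> weight v f + weight f v < 1.
Proof.
move=> F; have d0 := frame_den F.
rewrite /weight [dot f f * _]mulrC -mulrDl ltr_pdivrMr //.
case: F => _ _ _ _ vv ff; nra.
Qed.

Lemma weight_lt1 v e f : frame v e f -> weight v f < 1.
Proof.
move=> F; have := weightD F; have := weight_gt0 (frame_dual F); lra.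
Qed.

Lemma weight_v v e f : frame v e f -> weight v f * dot v v + weight f v = 1.
Proof.
move=> F; rewrite /weight [dot f f * _]mulrC; field.
by rewrite gt_eqF // (frame_den F).
Qed.

Lemma mirror_v v e f : frame v e f -> dot (mirror v e f) v = 0.
Proof.
move=> F; have := weight_v F; case: F => ee ve fe vf vv ff.
by rewrite /mirror !dotE (dotC e v) (dotC f v) ve vf; lra.
Qed.

Lemma mirror_f v e f : frame v e f -> dot (mirror v e f) f = 0.
Proof. by move=> /frame_dual F; rewrite mirror_dual mirror_v. Qed.

Lemma mirror_e v e f : frame v e f ->
  dot (mirror v e f) e = 1 - weight v f - weight f v.
Proof. by move=> [ee ve fe _ _ _]; rewrite /mirror !dotE ee ve fe; ring. Qed.

Lemma mirror_e_gt0 v e f : frame v e f -> 0 < dot (mirror v e f) e.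
Proof. by move=> F; rewrite mirror_e //; have := weightD F; lra. Qed.

Lemma mirror_mirror v e f : frame v e f ->
  dot (mirror v e f) (mirror v e f) = dot (mirror v e f) e.
Proof.
by move=> F; rewrite {2}/mirror !(dotDr, dotNr, dotZr) mirror_v // mirror_f //; ring.
Qed.

(** The chamber of the frame, bounded by the mirrors, is the cone on [v], [e]
    and [f]. *)
Lemma frame_coord v e f a : frame v e f ->
  a = (dot (v - e) a / (dot v v - 1)) *: v
    + (dot (mirror v e f) a / dot (mirror v e f) e) *: e
    + (dot (f - e) a / (dot f f - 1)) *: f.
Proof.
move=> F; apply/eqP; rewrite -subr_eq0; apply/eqP.
set d := _ - _.
have l0 : dot v v - 1 != 0 by rewrite subr_eq0 gt_eqF // (frame_vv F).
have k0 : dot f f - 1 != 0 by rewrite subr_eq0 gt_eqF // (frame_ff F).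
have m0 : dot (mirror v e f) e != 0 by rewrite gt_eqF // mirror_e_gt0.
have mv := mirror_v F; have mf := mirror_f F.
have w1 : 1 - weight v f - weight f v != 0.
  by rewrite -(mirror_e F).
have d1 : dot (v - e) d = 0.
  case: (F) => ee ve fe vf vv ff.
  rewrite /d; move: (dot (mirror v e f) a / _) => B.
  rewrite !dotE ee ve (dotC e v) ve vf (dotC e f) fe; field.
  by rewrite l0 k0.
have d2 : dot (mirror v e f) d = 0.
  rewrite /d !(dotDr, dotNr, dotZr) mv mf; field.
  by rewrite l0 m0 k0.
have d3 : dot (f - e) d = 0.
  case: (F) => ee ve fe vf vv ff.
  rewrite /d; move: (dot (mirror v e f) a / _) => B.
  rewrite !dotE ee (dotC f v) vf fe (dotC e v) ve (dotC e f) fe; field.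
  by rewrite l0 k0.
clearbody d; have de : dot d e = 0.
  move: d1 d2 d3; rewrite {1}/mirror !(dotDl, dotNl, dotZl) => d1 d2 d3.
  have ev : dot v d = dot e d by lra.
  have ef : dot f d = dot e d by lra.
  have /eqP : (1 - weight v f - weight f v) * dot d e = 0.
    by rewrite -[RHS]d2 ev ef (dotC d); ring.
  by rewrite mulf_eq0 (negPf w1) => /eqP.
move: d1 d3; rewrite !(dotDl, dotNl) !(dotC _ d) de => d1 d3.
by apply: (frame_ext F) => //; lra.
Qed.

Lemma reflect_v v e f : frame v e f -> reflection (v - e) v = 2 *: e - v.
Proof.
case=> ee ve fe vf vv ff; rewrite /reflection !dotE ee ve (dotC e v) ve.
apply/rowP => i; rewrite !mxE; field.
by rewrite lt0r_neq0 //; lra.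
Qed.

Lemma reflect_v_e v e f : frame v e f -> reflection (v - e) e = e.
Proof.
by case=> ee ve fe vf vv ff; rewrite reflection_fix // !dotE ee ve subrr.
Qed.

Lemma reflect_v_f v e f : frame v e f -> reflection (v - e) f = f.
Proof.
case=> ee ve fe vf vv ff.
by rewrite reflection_fix // !dotE vf (dotC e) fe subrr.
Qed.

Lemma reflect_e v e f : frame v e f ->
  reflection (mirror v e f) e =
    (2 * weight v f) *: v + (2 * weight f v) *: f - e.
Proof.
move=> F; rewrite /reflection mirror_mirror // mulfK; last first.
  by rewrite gt_eqF // mirror_e_gt0.
by rewrite /mirror; apply/rowP => i; rewrite !mxE; ring.
Qed.

Lemma reflect_e_v v e f : frame v e f -> reflection (mirror v e f) v = v.
Proof. by move=> F; rewrite reflection_fix // mirror_v. Qed.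

Lemma reflect_e_f v e f : frame v e f -> reflection (mirror v e f) f = f.
Proof. by move=> F; rewrite reflection_fix // mirror_f. Qed.

End Frames.

(** * Polar duality and chambers *)

Section DualPairs.
Variable R : realType.
Implicit Types (v e f a x y u n : 'rV[R]_3) (X Y : set 'rV[R]_3).

Definition face_normals v e f : set 'rV[R]_3 :=
  [set n | n = v - e \/ n = mirror v e f].

Definition normals v e f : set 'rV[R]_3 :=
  [set n | [\/ n = v - e, n = mirror v e f | n = f - e]].

Lemma face_normals_sub v e f : face_normals v e f `<=` normals v e f.
Proof. by move=> n [->|->]; [constructor 1|constructor 2]. Qed.

Lemma normals_dual v e f : normals v e f = normals f e v.
Proof.
rewrite /normals (mirror_dual v e f).
by apply/seteqP; split=> n [->|->|->];
  solve [constructor 1 => // | constructor 2 => // | constructor 3 => //].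
Qed.

Lemma face_normals_fix v e f h : frame v e f ->
  reflection_group (face_normals v e f) h -> h f = f.
Proof.
move=> F Gh; have st n x : face_normals v e f n -> x = f -> reflection n x = f.
  by move=> [->|->] ->; rewrite ?(reflect_v_f F) ?(reflect_e_f F).
exact: (reflection_group_stable (A := [set x | x = f]) st Gh).
Qed.

(** [X] stands for the polyhedron and [Y] for its polar; [v + e + f] is a point
    inside the chamber. The symmetry of these conditions under exchanging [v] with
    [f] and [X] with [Y] is polar duality. *)
Record dual_pair v e f X Y : Prop := DualPair {
  pair_frame : frame v e f;
  pair_finite :
    finite_set [set h (v + e + f) | h in reflection_group (normals v e f)];
  pair_stableX : forall n x, normals v e f n -> X x -> X (reflection n x);
  pair_stableY : forall n y, normals v e f n -> Y y -> Y (reflection n y);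
  pair_v : X v;
  pair_eX : X e;
  pair_eY : Y e;
  pair_f : Y f;
  pair_le : forall x y, X x -> Y y -> dot x y <= 1 }.

Lemma pair_dual v e f X Y : dual_pair v e f X Y -> dual_pair f e v Y X.
Proof.
case=> F fin sX sY Xv Xe Ye Yf le1; split=> //.
- exact: frame_dual.
- rewrite -(normals_dual v e f).
  by have -> : f + e + v = v + e + f by rewrite addrC addrA addrAC.
- by move=> n x; rewrite -(normals_dual v e f); exact: sY.
- by move=> n x; rewrite -(normals_dual v e f); exact: sX.
- by move=> y x Yy Xx; rewrite dotC; exact: le1.
Qed.

Lemma frame_center v e f n : frame v e f -> normals v e f n ->
  0 < dot n (v + e + f).
Proof.
move=> F [->|->|->].
- by rewrite !dotE !(gram F); have := frame_vv F; have := frame_ff F; lra.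
- by rewrite 2!dotDr mirror_v // mirror_f // add0r addr0 mirror_e_gt0.
- by rewrite !dotE !(gram F); have := frame_vv F; have := frame_ff F; lra.
Qed.

Lemma chamber_face v e f X Y a : dual_pair v e f X Y ->
  exists2 h, reflection_group (face_normals v e f) h &
    exists al be ga, [/\ 0 <= al, 0 <= be & h a = al *: v + be *: e + ga *: f].
Proof.
move=> D; have F := pair_frame D.
have [||h Gh hpos] := @move_to_chamber R (face_normals v e f) (v + e + f) _ _ a.
- apply: sub_finite_set (pair_finite D) => _ [h Gh <-]; exists h => //.
  exact: reflection_groupS (@face_normals_sub v e f) Gh.
- by move=> n /face_normals_sub; exact: frame_center.
exists h => //; do 3!eexists; split; last exact: frame_coord F.
- rewrite divr_ge0 ?hpos //; first by left.
  by rewrite subr_ge0 ltW // (frame_vv F).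
- rewrite divr_ge0 ?hpos //; first by right.
  by rewrite ltW // mirror_e_gt0.
Qed.

Lemma chamber v e f a : frame v e f ->
  finite_set [set h (v + e + f) | h in reflection_group (normals v e f)] ->
  exists2 h, reflection_group (normals v e f) h &
    exists al be ga, [/\ 0 <= al, 0 <= be, 0 <= ga
                      & h a = al *: v + be *: e + ga *: f].
Proof.
move=> F fin.
have [//||h Gh hpos] := @move_to_chamber R (normals v e f) (v + e + f) _ _ a.
  by move=> n; exact: frame_center.
exists h => //; do 3!eexists; split; last exact: frame_coord F.
- rewrite divr_ge0 ?hpos //; first by constructor 1.
  by rewrite subr_ge0 ltW // (frame_vv F).
- rewrite divr_ge0 ?hpos //; first by constructor 2.
  by rewrite ltW // mirror_e_gt0.
- rewrite divr_ge0 ?hpos //; first by constructor 3.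
  by rewrite subr_ge0 ltW // (frame_ff F).
Qed.

Lemma stableX v e f X Y h x : dual_pair v e f X Y ->
  reflection_group (normals v e f) h -> X x -> X (h x).
Proof. by move=> D Gh; apply: (reflection_group_stable _ Gh); exact: pair_stableX D. Qed.

Lemma stableY v e f X Y h y : dual_pair v e f X Y ->
  reflection_group (normals v e f) h -> Y y -> Y (h y).
Proof. by move=> D Gh; apply: (reflection_group_stable _ Gh); exact: pair_stableY D. Qed.

(** A point of [Y] in the chamber of the stabilizer of [f] lies on the inner side
    of [f] by the inequalities that [v] and [e] impose on it. *)
Lemma support_f v e f X Y y : dual_pair v e f X Y -> Y y ->
  dot f y <= dot f f.
Proof.
move=> D; have F := pair_frame D; move: y.
suff main y al be ga : Y y -> 0 <= al -> 0 <= be ->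
    y = al *: v + be *: e + ga *: f -> dot f y <= dot f f.
  move=> y Yy; have [h Gh [al [be [ga [al0 be0 hy]]]]] := chamber_face y D.
  have [h' Gh' [_ _ adj]] := reflection_group_adjoint Gh.
  rewrite -[f in dot f y](face_normals_fix F Gh') dotC -adj dotC.
  apply: main al0 be0 hy; apply: stableY D _ Yy.
  exact: reflection_groupS (@face_normals_sub v e f) Gh.
move=> Yy al0 be0 yE; rewrite leNgt; apply/negP => fy.
have vy := pair_le D (pair_v D) Yy; have ey := pair_le D (pair_eX D) Yy.
case: (F) => ee ve fe vf vv ff.
have vyE : dot v y = al * dot v v + be + ga by rewrite yE !dotE ve vf; ring.
have ga1 : ga <= 1 by move: vy; rewrite vyE; nra.
have : dot (y - f) (y - f) <= 0.
  rewrite {2}yE !(dotDr, dotNr, dotZr) !(dotDl, dotNl) (dotC y v) (dotC y e).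
  by rewrite (dotC y f) (dotC f v) vf fe; nra.
rewrite le_eqVlt ltNge dot_ge0 orbF dot_eq0 subr_eq0 => /eqP yf.
by move: fy; rewrite yf ltxx.
Qed.

(** Every linear functional attains its maximum on [Y] somewhere in the orbit of
    [f]: for a functional in the chamber, at [f] itself. *)
Lemma max_in_orbit_f v e f X Y a : dual_pair v e f X Y ->
  exists2 h, reflection_group (normals v e f) h &
    forall y, Y y -> dot a y <= dot a (h f).
Proof.
move=> D; have F := pair_frame D.
have [h Gh [al [be [ga [al0 be0 ga0 hE]]]]] := chamber a F (pair_finite D).
have [h' Gh' [hK h'K adj]] := reflection_group_adjoint Gh.
exists h' => // y Yy; rewrite -adj -[y]hK -adj hE.
have Yhy := stableY D Gh Yy.
have := pair_le D (pair_v D) Yhy; have := pair_le D (pair_eX D) Yhy.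
have := support_f D Yhy; case: (F) => ee ve fe vf vv ff.
by rewrite !dotE (dotC e f) vf fe; nra.
Qed.

End DualPairs.

(** * Counting the vertices of a face *)

Section Counting.
Variable R : realType.
Implicit Types (v e f u n : 'rV[R]_3) (X Y : set 'rV[R]_3).

Lemma cos_chord_gt (theta alpha : R) : 0 < alpha < theta -> theta < pi ->
  1 + cos theta < cos alpha + cos (alpha - theta).
Proof.
move=> /andP[a0 at_] tp; pose h := theta / 2; pose b := alpha - h.
have hb : b < h by rewrite /b /h; lra.
have hb' : - h < b by rewrite /b /h; lra.
have hp : h < pi / 2 by rewrite /h; lra.
have p0 := pi_gt0 R.
have -> : theta = h + h by rewrite /h; field.
have -> : alpha = b + h by rewrite /b; ring.
have -> : b + h - (h + h) = b - h by ring.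
clearbody b; clearbody h; rewrite !cosD cosN sinN.
have h0 : 0 < cos h by apply: cos_gt0_pihalf; apply/andP; split; lra.
have bh : cos h < cos b.
  have hI : h \in `[0, pi] by rewrite in_itv /=; apply/andP; split; lra.
  have [b0|b0] := leP 0 b.
    by rewrite ltr_cos // in_itv /=; apply/andP; split; lra.
  rewrite -(cosN b) ltr_cos //; first by lra.
  by rewrite in_itv /=; apply/andP; split; lra.
have d0 : 0 < cos h * (cos b - cos h) by rewrite mulr_gt0 // subr_gt0.
have := cos2Dsin2 h; rewrite !expr2; lra.
Qed.

(** An angle whose multiples never fall strictly between [0] and itself, modulo
    a full turn, divides the full turn. *)
Lemma angle_divides_turn (theta : R) : 0 < theta < pi ->
  (forall j : nat,
     cos (j%:R * theta) + cos (j%:R * theta - theta) <= 1 + cos theta) ->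
  exists2 k : nat, (0 < k)%N & k%:R * theta = 2 * pi.
Proof.
move=> /andP[t0 tp] hj; have p0 := pi_gt0 R.
have q0 : 0 <= 2 * pi / theta by rewrite divr_ge0 ?mulr_ge0 // ltW.
have := truncn_itv q0; set k := Num.trunc _ => /andP[k1 k2].
move: k1 k2; rewrite ler_pdivlMr // ltr_pdivrMr // => k1 k2.
have kE : k%:R * theta = 2 * pi.
  apply/eqP; rewrite eq_le k1 /= leNgt; apply/negP => k3.
  have := hj k.+1; rewrite leNgt => /negP; apply.
  have kS : k.+1%:R * theta = k%:R * theta + theta.
    by rewrite -natr1 mulrDl mul1r.
  rewrite kS in k2 *; rewrite addrK.
  pose x := k%:R * theta + theta - 2 * pi.
  have e1 : k%:R * theta + theta = x + pi *+ 2 by rewrite /x mulr2n; ring.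
  have e2 : k%:R * theta = x - theta + pi *+ 2 by rewrite /x mulr2n; ring.
  rewrite e1 e2 !cosD2pi; apply: cos_chord_gt => //.
  by rewrite /x; apply/andP; split; lra.
exists k => //; case: k kE {k1 k2} => // kE.
by move: kE; rewrite mul0r; lra.
Qed.

Lemma cos_eq1 (x : R) : 0 <= x < 2 * pi -> cos x = 1 -> x = 0.
Proof.
move=> /andP[x0 x1]; have -> : x = (x / 2) *+ 2 by rewrite mulr2n; field.
rewrite cos_mulr2n => h.
have s0 : sin (x / 2) = 0.
  have := cos2Dsin2 (x / 2); rewrite mulr2n in h => h2.
  by apply/eqP; rewrite -sqrf_eq0; apply/eqP; lra.
have [x2|x2] := ltP 0 (x / 2).
  have : 0 < sin (x / 2) by apply: sin_gt0_pi; apply/andP; split; lra.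
  by rewrite s0 ltxx.
have -> : x / 2 = 0 by lra.
exact: mul0rn.
Qed.

(** The circle through [v] around the axis [f]. When [theta] is the angle from [v]
    to its neighbour, [(2 / sin theta) *: mirror v e f] is the radius orthogonal to
    the one that ends at [v]. *)
Definition turn v e f (theta alpha : R) : 'rV[R]_3 :=
  (dot f f)^-1 *: f + cos alpha *: (v - (dot f f)^-1 *: f)
    + (2 * sin alpha / sin theta) *: mirror v e f.

Section Turn.
Variables (v e f : 'rV[R]_3) (F : frame v e f).
Let theta := acos (2 * weight v f - 1).

Let s0 : 0 < weight v f. Proof. exact: weight_gt0 F. Qed.
Let s1 : weight v f < 1. Proof. exact: weight_lt1 F. Qed.

Lemma turn_angle : 0 < theta < pi.
Proof.
move: s0 s1 => s0' s1'; rewrite /theta acos_gt0 ?acos_ltpi //; apply/andP; split; lra.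
Qed.

Lemma cos_turn_angle : cos theta = 2 * weight v f - 1.
Proof. by rewrite /theta acosK // in_itv /=; apply/andP; split; move: s0 s1; lra. Qed.

Let st : 0 < sin theta. Proof. by apply: sin_gt0_pi; exact: turn_angle. Qed.

Let sst : sin theta ^+ 2 = 4 * weight v f * (1 - weight v f).
Proof. by have := cos2Dsin2 theta; rewrite cos_turn_angle; lra. Qed.

Let ff0 : dot f f != 0.
Proof. by rewrite gt_eqF // (lt_trans _ (frame_ff F)). Qed.

Let tE : weight f v = (1 - weight v f) / dot f f.
Proof. by apply: (mulIf ff0); rewrite divfK //; have := weight_v (frame_dual F); lra. Qed.

Lemma turn0 : turn v e f theta 0 = v.
Proof.
by rewrite /turn cos0 sin0 mulr0 mul0r scale0r scale1r addr0 addrC subrK.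
Qed.

Lemma turn_periodic alpha : turn v e f theta (alpha + pi *+ 2) = turn v e f theta alpha.
Proof. by rewrite /turn cosD2pi sinD2pi. Qed.

Lemma reflect_e_turn alpha :
  reflection (mirror v e f) (turn v e f theta alpha) = turn v e f theta (- alpha).
Proof.
have rm : reflection (mirror v e f) (mirror v e f) = - mirror v e f.
  rewrite /reflection mulfK ?mirror_mirror // ?gt_eqF ?mirror_e_gt0 //.
  by rewrite scaler_nat mulr2n opprD addrA subrr add0r.
have rv := reflect_e_v F; have rf := reflect_e_f F.
rewrite /turn cosN sinN; move: (mirror v e f) rm rv rf => m rm rv rf.
by rewrite !reflectionE rv rf rm scalerN mulrN mulNr scaleNr.
Qed.

Lemma reflect_v_turn alpha :
  reflection (v - e) (turn v e f theta alpha) = turn v e f theta (theta - alpha).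
Proof.
rewrite /turn /mirror !reflectionE (reflect_v F) (reflect_v_e F) (reflect_v_f F).
rewrite cosD sinD cosN sinN cos_turn_angle /mirror tE.
have st0 : sin theta != 0 by rewrite gt_eqF.
have sq : sin theta * sin theta = 4 * weight v f * (1 - weight v f).
  by rewrite -sst expr2.
apply/rowP => i; rewrite !mxE; apply: (mulIf st0); apply: subr0_eq.
transitivity (sin alpha * (4 * weight v f * (1 - weight v f)
    - sin theta * sin theta) * (v 0 i - (dot f f)^-1 * f 0 i)).
  by field; rewrite st0 ff0.
by rewrite sq subrr mulr0 mul0r.
Qed.

Lemma dot_turn_e alpha :
  dot (turn v e f theta alpha) e
  = (dot f f)^-1 + (1 - (dot f f)^-1) / (2 * weight v f)
                   * (cos alpha + cos (alpha - theta)).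
Proof.
have st0 : sin theta != 0 by rewrite gt_eqF.
have sq : sin theta * sin theta = 4 * weight v f * (1 - weight v f).
  by rewrite -sst expr2.
have w0 : weight v f != 0 by rewrite gt_eqF.
have me := mirror_e F; rewrite /turn; move: (mirror v e f) me => m me.
rewrite !dotE !(gram F) me tE cosD cosN sinN cos_turn_angle.
apply: (mulIf st0); apply: subr0_eq.
transitivity (sin alpha * (4 * weight v f * (1 - weight v f)
    - sin theta * sin theta) * (1 - (dot f f)^-1) / (2 * weight v f)).
  by field; rewrite st0 ff0 w0.
by rewrite sq subrr mulr0 !mul0r.
Qed.

Lemma dot_turn alpha beta :
  dot (turn v e f theta alpha) (turn v e f theta beta)
  = (dot f f)^-1 + (1 - (dot f f)^-1) / weight v f * cos (alpha - beta).
Proof.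
have st0 : sin theta != 0 by rewrite gt_eqF.
have sq : sin theta * sin theta = 4 * weight v f * (1 - weight v f).
  by rewrite -sst expr2.
have w0 : weight v f != 0 by rewrite gt_eqF.
have w1 : 1 - weight v f != 0 by rewrite subr_eq0 eq_sym lt_eqF.
have vE : dot v v = (1 - weight f v) / weight v f.
  by apply: (mulIf w0); rewrite divfK //; have := weight_v F; lra.
have mv := mirror_v F; have mf := mirror_f F.
have := mirror_mirror F; rewrite (mirror_e F) => mm.
rewrite /turn; move: (mirror v e f) mv mf mm => m mv mf mm.
rewrite !dotE !(gram F) (dotC v m) (dotC f m) mv mf mm vE tE cosD cosN sinN.
apply: (mulIf (mulf_neq0 st0 st0)); apply: subr0_eq.
transitivity (sin alpha * sin beta * (4 * weight v f * (1 - weight v f)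
    - sin theta * sin theta) * (1 - (dot f f)^-1) / weight v f).
  by field; rewrite st0 ff0 w0.
by rewrite sq subrr mulr0 !mul0r.
Qed.

End Turn.

Definition vertex_orbit v e f : set 'rV[R]_3 :=
  [set h v | h in reflection_group (normals v e f)].

Lemma vertex_orbitX v e f X Y u :
  dual_pair v e f X Y -> vertex_orbit v e f u -> X u.
Proof. by move=> D [h Gh <-]; exact: (stableX D Gh (pair_v D)). Qed.

Lemma vertex_orbit_norm v e f u : vertex_orbit v e f u -> dot u u = dot v v.
Proof. by move=> [h Gh <-]; exact: (reflection_group_isom Gh v v). Qed.

Lemma vertex_orbit_stable v e f n u : normals v e f n ->
  vertex_orbit v e f u -> vertex_orbit v e f (reflection n u).
Proof.
move=> Nn [h Gh <-]; exists (reflection n \o h) => //.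
exact: reflection_group_comp.
Qed.

(** The symmetries of a face permute its vertices transitively: in the chamber of
    the stabilizer of [f], the only vertex of the face is [v]. *)
Lemma face_vertex_orbit v e f X Y u : dual_pair v e f X Y ->
  vertex_orbit v e f u -> dot f u = 1 ->
  exists2 h, reflection_group (face_normals v e f) h & u = h v.
Proof.
move=> D Vu fu; have F := pair_frame D.
have [h Gh [al [be [ga [al0 be0 hE]]]]] := chamber_face u D.
have [h' Gh' [hK h'K adj]] := reflection_group_adjoint Gh.
exists h' => //; rewrite -[LHS]hK; congr h'.
have Xhu : X (h u).
  apply: stableX D _ (vertex_orbitX D Vu).
  exact: reflection_groupS (@face_normals_sub R v e f) Gh.
have hh : dot (h u) (h u) = dot v v.
  by rewrite (reflection_group_isom Gh) (vertex_orbit_norm Vu).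
have fh : dot f (h u) = 1.
  by rewrite dotC adj (face_normals_fix (pair_frame D) Gh') dotC.
have vh := support_f (pair_dual D) Xhu.
have eh : dot e (h u) <= 1 by rewrite dotC; exact: (pair_le D Xhu (pair_eY D)).
have hv : dot (h u) (h u) <= dot (h u) v.
  rewrite {1}hE !dotE fh (dotC (h u) v).
  have vE : dot v (h u) = al * dot v v + be + ga.
    by rewrite hE !dotE !(gram F); ring.
  have p1 : 0 <= al * (dot v v - dot v (h u)) by rewrite mulr_ge0 // subr_ge0.
  have p2 : 0 <= be * (1 - dot e (h u)) by rewrite mulr_ge0 // subr_ge0.
  lra.
by apply: dot_max_eq => //; rewrite -hh.
Qed.

(** The vertices of the face are the images of [v] under the multiples of the
    turn. None of them lies between [v] and its neighbour [2 *: e - v], because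
    [e] supports the edge joining them, so that the turn is a [p]-th of a full
    turn rather than a multiple of it. *)
Theorem weight_of_count v e f X Y p : dual_pair v e f X Y ->
  ([set u | vertex_orbit v e f u /\ dot f u = 1] #= `I_p)%card ->
  omega R p = 4 * weight v f - 1.
Proof.
move=> D; set O := [set u | _] => cardO; have F := pair_frame D.
pose theta := acos (2 * weight v f - 1).
have /andP[t0 tp] : 0 < theta < pi := turn_angle F.
pose T (j : nat) := turn v e f theta (j%:R * theta).
have w0 := weight_gt0 F.
have OT j : O (T j).
  elim: j => [|j [Vj fj]].
    rewrite /T mul0r turn0; split; last by rewrite !(gram F).
    by exists id => //; exact: reflection_group_id.
  have -> : T j.+1 = reflection (v - e) (reflection (mirror v e f) (T j)).
    rewrite /T (reflect_e_turn F) (reflect_v_turn F).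
    by rewrite opprK -natr1 mulrDl mul1r addrC.
  split.
    by do 2!(apply: vertex_orbit_stable; first by constructor).
  by rewrite -!dot_reflectionl (reflect_v_f F) (reflect_e_f F).
have [||k k0 kE] := @angle_divides_turn theta; first by rewrite t0.
  move=> j; have [Vj _] := OT j.
  have := pair_le D (vertex_orbitX D Vj) (pair_eY D).
  rewrite (dot_turn_e F) (cos_turn_angle F) -/theta => le1.
  have i1 : 0 < 1 - (dot f f)^-1.
    rewrite subr_gt0 invf_lt1 ?(frame_ff F) //.
    exact: lt_trans ltr01 (frame_ff F).
  have : (1 - (dot f f)^-1) / (2 * weight v f) *
      (cos (j%:R * theta) + cos (j%:R * theta - theta)) <= 1 - (dot f f)^-1.
    by lra.
  rewrite mulrAC ler_pdivrMr ?ler_pM2l //; last by lra.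
  by move=> h; apply: le_trans h _; lra.
have Tk j : T (k + j)%N = T j.
  by rewrite /T natrD mulrDl kE addrC [2 * pi]mulr_natl turn_periodic.
have Tmod j : T j = T (j %% k)%N.
  rewrite {1}(divn_eq j k); elim: (j %/ k)%N => [|i IH]; first by rewrite mul0n.
  by rewrite mulSn -addnA Tk.
have Tinj : {in `I_k &, injective T}.
  suff main i j : (j <= i < k)%N -> T i = T j -> i = j.
    move=> i j; rewrite !inE /= => ik jk Tij.
    by case/orP: (leq_total i j) => ij; [symmetry|]; apply: main; rewrite ?ij.
  move=> /andP[ji ik] Tij.
  have := dot_turn F (i%:R * theta) (i%:R * theta).
  rewrite -/(T i) {2}Tij (dot_turn F) subrr cos0 => /addrI /mulfI c1.
  have : i%:R * theta - j%:R * theta = 0.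
    apply: cos_eq1.
      rewrite -mulrBl -natrB // mulr_ge0 ?ler0n ?ltW //= -kE ltr_pM2r // ltr_nat.
      exact: leq_ltn_trans (leq_subr _ _) ik.
    apply: c1; rewrite mulf_neq0 ?invr_eq0 ?gt_eqF // subr_gt0.
    rewrite invf_lt1 ?(frame_ff F) //; exact: lt_trans ltr01 (frame_ff F).
  by rewrite -mulrBl => /eqP; rewrite mulf_eq0 (gt_eqF t0) orbF subr_eq0 eqr_nat
    => /eqP.
have OE : O = T @` `I_k.
  apply/seteqP; split=> [u [Vu fu]|_ [j _ <-]]; last exact: OT.
  have [h Gh ->] := face_vertex_orbit D Vu fu.
  apply: (reflection_group_stable (A := T @` `I_k) _ Gh); last first.
    by exists 0%N => //; rewrite /T mul0r turn0.
  suff st x n : (T @` `I_k) x -> face_normals v e f n ->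
      exists j, reflection n x = T j.
    move=> n x Nn Ax; have [j ->] := st x n Ax Nn.
    by exists (j %% k)%N; rewrite -?Tmod //= ltn_mod.
  move=> [j /= jk <-] [->|->].
    exists (k.+1 - j)%N; rewrite (reflect_v_turn F) -turn_periodic -/theta /T.
    congr turn; rewrite natrB; last exact: leqW (ltnW jk).
    by rewrite -natr1 !mulrDl mul1r kE mulr2n mulNr; ring.
  exists (k - j)%N; rewrite (reflect_e_turn F) -turn_periodic /T.
  congr turn; rewrite natrB ?(ltnW jk) //.
  by rewrite mulrDl kE mulr2n mulNr; ring.
have kp : k = p.
  apply/card_eq_II; apply: card_eq_trans cardO.
  by rewrite OE card_eq_sym; exact: inj_card_eq.
rewrite /omega -kp -kE mulrAC divff ?mul1r ?pnatr_eq0 -?lt0n //.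
by rewrite (cos_turn_angle F); ring.
Qed.

End Counting.

(** * From a flag of the polyhedron to its frame *)

Section Polytopes.
Variable R : realType.
Implicit Types (v e f a x y u n : 'rV[R]_3) (P F E G : set 'rV[R]_3).

Lemma reflection_mulmx n : exists2 Q : 'M[R]_3, Q *m Q = 1%:M &
  forall x, reflection n x = x *m Q.
Proof.
pose Q : 'M[R]_3 := 1%:M - (2 / dot n n) *: (n^T *m n).
have QE x : reflection n x = x *m Q.
  rewrite /Q mulmxBr mulmx1 -scalemxAr mulmxA /reflection.
  congr (_ - _); rewrite [x *m n^T]mx11_scalar mul_scalar_mx scalerA.
  by rewrite -dot_mulmx_tr (dotC n x) mulrAC.
exists Q => //; apply/row_matrixP => i.
by rewrite row_mul [row i Q]rowE -!QE reflectionK rowE mulmx1.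
Qed.

Lemma affine_dim_reflection F k n :
  affine_dim F k -> affine_dim (reflection n @` F) k.
Proof.
have [Q QQ QE] := reflection_mulmx n.
have uQ : Q \in unitmx by case/mulmx1_unit: QQ.
move=> [x0 [A [Fx0 fA FA hull]]]; exists (reflection n x0), (A *m Q).
split=> [||i|_ [x Fx <-]]; first by exists x0.
- by rewrite /row_free mxrankMfree ?row_free_unit.
- by exists (x0 + row i A); rewrite ?reflectionD ?row_mul ?QE.
- by rewrite -reflectionN -reflectionD QE submxMr // hull.
Qed.

Lemma face_reflection P F n : (forall x, P x -> P (reflection n x)) ->
  face P F -> face P (reflection n @` F).
Proof.
move=> stP [[x0 Fx0] [a [c [hP FE]]]]; split; first by exists (reflection n x0), x0.
exists (reflection n a), c; split=> [x Px|].
  by rewrite dot_reflectionl; apply/hP/stP.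
apply/seteqP; split=> [_ [x Fx <-]|x [Px xc]] /=.
  have : F x by []. rewrite {1}FE => -[Px xc].
  by split; [exact: stP|rewrite dot_reflectionl reflectionK].
exists (reflection n x); last exact: reflectionK.
by rewrite FE; split; [exact: stP|rewrite -dot_reflectionl].
Qed.

Lemma face_of_dim_reflection P F k n : (forall x, P x -> P (reflection n x)) ->
  face_of_dim P k F -> face_of_dim P k (reflection n @` F).
Proof.
by move=> stP [fF dF]; split; [exact: face_reflection|exact: affine_dim_reflection].
Qed.

Lemma vertex_reflection P v n : (forall x, P x -> P (reflection n x)) ->
  vertex P v -> vertex P (reflection n v).
Proof.
by move=> stP /(face_of_dim_reflection stP); rewrite /vertex image_set1.
Qed.

(** The vertices of a convex hull are among the points that span it. *)
Lemma finite_vertex P : polytope P -> finite_set (vertex P).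
Proof.
move=> [m [A PE]].
apply: (@sub_finite_set _ _ ((fun i => row i A) @` [set: 'I_m])); last first.
  by apply: finite_image; exact: finite_finset.
move=> v [[_ [a [c [hP vE]]]] _].
have rowP i : P (row i A).
  rewrite PE; exists (delta_mx 0 i); split=> [j||].
  - by rewrite mxE /= ler0n.
  - rewrite (bigD1 i) //= big1 => [|j ji]; last by rewrite mxE /= (negPf ji).
    by rewrite mxE !eqxx addr0.
  - by rewrite rowE.
have [Pv va] : P v /\ dot a v = c.
  by have : [set v] v by []; rewrite {1}vE.
have : P v by []. rewrite {1}PE => -[w [w0 w1 vw]].
have av : dot a v = \sum_i w 0 i * dot a (row i A).
  rewrite vw mulmx_sum_row /dot.
  under eq_bigr => j _ do rewrite summxE big_distrr /=.
  rewrite exchange_big /=; apply: eq_bigr => i _.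
  by rewrite big_distrr /=; apply: eq_bigr => j _; rewrite !mxE; ring.
have : \sum_i w 0 i * (c - dot a (row i A)) = 0.
  under eq_bigr => i _ do rewrite mulrBr.
  by rewrite sumrB -mulr_suml w1 mul1r -av va subrr.
move=> /eqP; rewrite psumr_eq0; last first.
  by move=> i _; rewrite mulr_ge0 // subr_ge0 hP.
move=> /allP w_eq.
have [i wi] : exists i, w 0 i != 0.
  apply/existsP; rewrite -negb_forall; apply/negP => /forallP w00.
  have : \sum_i w 0 i = 0 by apply: big1 => i _; apply/eqP; exact: w00.
  by rewrite w1 => /eqP; rewrite oner_eq0.
exists i => //; have := w_eq i (mem_index_enum i).
rewrite /= mulf_eq0 (negPf wi) /= subr_eq0 eq_sym => /eqP ri.
by have : [set v] (row i A) by rewrite vE; split.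
Qed.

(** Three points of a plane that avoids the origin are linearly independent when
    they are affinely independent. *)
Lemma normal_unique (x0 : 'rV[R]_3) (A : 'M[R]_(2, 3)) g y : row_free A ->
  dot g x0 = 1 -> (forall i, dot g (x0 + row i A) = 1) ->
  dot y x0 = 1 -> (forall i, dot y (x0 + row i A) = 1) -> y = g.
Proof.
move=> fA g0 gA y0 yA.
have A0 z : dot z x0 = 1 -> (forall i, dot z (x0 + row i A) = 1) -> A *m z^T = 0.
  move=> z0 zA; apply/row_matrixP => i.
  rewrite row_mul row0 [LHS]mx11_scalar -dot_mulmx_tr.
  have := zA i; rewrite dotDr z0 dotC => /eqP.
  by rewrite -subr_eq0 addrAC subrr add0r => /eqP ->; rewrite raddf0.
pose B : 'M[R]_(1 + 2, 3) := col_mx x0 A.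
have fB : row_free B.
  apply/inj_row_free => w; rewrite -[w]hsubmxK mul_row_col => h.
  have w0 : lsubmx w = 0.
    have := congr1 (mulmxr g^T) h; rewrite /= mulmxDl -!mulmxA (A0 g g0 gA) mulmx0.
    rewrite addr0 mul0mx [x0 *m _]mx11_scalar -dot_mulmx_tr dotC g0.
    by rewrite mulmx1.
  move: h; rewrite w0 mul0mx add0r => h.
  have -> : rsubmx w = 0.
    by apply: (row_free_inj fA); rewrite h mul0mx.
  by rewrite row_mx0.
have Bd : B *m (y - g)^T = 0.
  have x0E z : dot z x0 = 1 -> x0 *m z^T = 1%:M.
    by move=> h; rewrite [LHS]mx11_scalar -dot_mulmx_tr dotC h.
  rewrite /B mul_col_mx linearB /= !mulmxBr (A0 g g0 gA) (A0 y y0 yA) subrr.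
  by rewrite (x0E g g0) (x0E y y0) subrr col_mx0.
have uB : (B : 'M[R]_3) \in unitmx by rewrite -row_free_unit.
apply/eqP; rewrite -subr_eq0 -[_ - _]trmxK.
by rewrite -(mulKmx uB (y - g)^T) Bd mulmx0 trmx0.
Qed.

Lemma reflection_moved n x : reflection n x != x ->
  reflection n = reflection (x - reflection n x).
Proof.
move=> h; have -> : x - reflection n x = (2 * dot n x / dot n n) *: n.
  by rewrite /reflection opprB addrC subrK.
rewrite reflection_scale //; apply: contra h => /eqP h.
by rewrite /reflection h scale0r subr0.
Qed.

(** A reflection that moves [x] within a plane fixes the normal of the plane. *)
Lemma dot_moved n x a : reflection n x != x ->
  dot a (reflection n x) = dot a x -> dot n a = 0.
Proof.
move=> h /eqP; rewrite {1}/reflection !dotE -subr_eq0 addrAC subrr add0r oppr_eq0.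
rewrite mulf_eq0 => /orP[/eqP h0|/eqP]; last by rewrite dotC.
by move: h; rewrite /reflection h0 scale0r subr0 eqxx.
Qed.

(** [v + e + f] is a linear combination of three points of the orbit of [v]. *)
Lemma finite_orbit v e f (S : set 'rV[R]_3) : frame v e f -> finite_set S -> S v ->
  (forall n x, normals v e f n -> S x -> S (reflection n x)) ->
  finite_set [set h (v + e + f) | h in reflection_group (normals v e f)].
Proof.
move=> F finS Sv st.
pose v2 := reflection (v - e) v; pose v3 := reflection (mirror v e f) v2.
pose t2 := (2 * weight f v)^-1.
pose comb (x : 'rV[R]_3 * 'rV[R]_3 * 'rV[R]_3) :=
  (3 / 2 + t2 * (1 - 2 * weight v f)) *: x.1.1
  + ((1 + t2) / 2) *: x.1.2 + (t2 / 2) *: x.2.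
have w0 : weight f v != 0 by rewrite gt_eqF // (weight_gt0 (frame_dual F)).
have cE : v + e + f = comb (v, v2, v3).
  rewrite /comb /= /v3 /v2 (reflect_v F) !reflectionE (reflect_e F) (reflect_e_v F).
  by apply/rowP => i; rewrite !mxE /t2; field.
apply: sub_finite_set (finite_image comb (finite_setX (finite_setX finS finS) finS)).
move=> _ [h Gh <-]; exists (h v, h v2, h v3).
  have st' x : S x -> S (h x) by move: x; apply: (reflection_group_stable _ Gh).
  have Sv2 : S v2 by apply: st => //; constructor 1.
  have Sv3 : S v3 by apply: st => //; constructor 2.
  by split; first split; exact: st'.
rewrite cE /comb; clearbody v2 v3.
by rewrite /= !(reflection_groupD Gh) !(reflection_groupZ Gh).
Qed.

(** The reflections are recovered from points that they move: [v] for the first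
    one, and [f] for the third one. The inequalities defining the polar hold
    because [f] is the normal of a face, and because [e] is the midpoint of [f] and
    of its image under the third reflection. *)
Lemma dual_pair_of_flag P fl r1 r2 r3 v :
  polytope P -> affine_dim P 3 ->
  (forall E, face_of_dim P 1 E -> tangent_to_sphere E) ->
  flag P fl -> flag_reflection fl 1 r1 -> flag_reflection fl 2 r2 ->
  flag_reflection fl 3 r3 -> fl ord0 = [set v] ->
  exists e f, [/\ dual_pair v e f P (polar P), r1 = reflection (v - e),
    r2 = reflection (mirror v e f), r3 = reflection (f - e) &
    face_of_dim P 2 [set x | P x /\ dot f x = 1]].
Proof.
move=> polyP dimP tang [flP fldim flsub] [[n1 n10 ->] fix1] [[n2 n20 ->] fix2].
move=> [[n3 n30 ->] fix3] fl0.
pose i1 : 'I_4 := Ordinal (isT : (1 < 4)%N).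
pose i2 : 'I_4 := Ordinal (isT : (2 < 4)%N).
pose E := fl i1; pose F := fl i2.
have st n i (k : 'I_4) : (forall k : 'I_4, reflection n @` fl k = fl k <-> k.+1 <> i) ->
    k.+1 <> i -> forall x, fl k x -> fl k (reflection n x).
  by move=> h ki x; apply: reflection_preserves; apply/h.
have stP1 x : P x -> P (reflection n1 x) by rewrite -flP; exact: st fix1 _ _.
have stP2 x : P x -> P (reflection n2 x) by rewrite -flP; exact: st fix2 _ _.
have stP3 x : P x -> P (reflection n3 x) by rewrite -flP; exact: st fix3 _ _.
have stE1 x : E x -> E (reflection n1 x) by exact: st fix1 _ _.
have stE3 x : E x -> E (reflection n3 x) by exact: st fix3 _ _.
have stF1 x : F x -> F (reflection n1 x) by exact: st fix1 _ _.
have stF2 x : F x -> F (reflection n2 x) by exact: st fix2 _ _.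
have fl0v : fl ord0 v by rewrite fl0.
have r2v : reflection n2 v = v.
  by have : fl ord0 (reflection n2 v) by [apply: (st _ _ _ fix2)]; rewrite fl0.
have r3v : reflection n3 v = v.
  by have : fl ord0 (reflection n3 v) by [apply: (st _ _ _ fix3)]; rewrite fl0.
have [v2 v2D] : exists v2, v2 = reflection n1 v by exists (reflection n1 v).
have r1v2 : reflection n1 v2 = v by rewrite v2D reflectionK.
have v2v : v2 != v.
  apply/eqP => h; have := (fix1 ord0).1; rewrite fl0 image_set1 -v2D h.
  by move=> /(_ erefl); apply.
have Ev : E v by exact: flsub (ord0) i1 isT _ fl0v.
have Ev2 : E v2 by rewrite v2D; exact: stE1.
have EF x : E x -> F x by exact: flsub i1 i2 isT _.
have FP x : F x -> P x by rewrite -flP; exact: flsub i2 ord_max isT _.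
have line x : E x -> exists t, x = v + t *: (v2 - v).
  have [_ [x0 [A [_ _ _ hull]]]] := fldim i1.
  have cx y : E y -> exists t, y = x0 + t *: row 0 A.
    have AE : row 0 A = A by apply/rowP => j; rewrite !mxE.
    move=> /hull; rewrite -{1}AE => /sub_rVP[t h].
    by exists t; rewrite -h addrC subrK.
  move=> /cx[t ->]; have [t1 v_] := cx _ Ev; have [t2 v2_] := cx _ Ev2.
  have t12 : t2 - t1 != 0.
    by apply: contra v2v; rewrite subr_eq0 v_ v2_ => /eqP ->.
  exists ((t - t1) / (t2 - t1)); rewrite v_ v2_.
  by apply/rowP => j; rewrite !mxE; field.
(* The point of tangency is unique, hence fixed by the reflections of the edge. *)
have [e [Ee ee eE]] := tang _ (fldim i1).
rewrite /sphere /= in ee.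
have fixe n : (forall x, E x -> E (reflection n x)) -> reflection n e = e.
  move=> h; have := eE _ (h _ Ee); rewrite dotC => he.
  by apply: dot_max_eq; rewrite ?reflection_isom he ee.
have r1e := fixe _ stE1; have r3e := fixe _ stE3.
have v2E : v2 = 2 *: e - v.
  have [t et] := line _ Ee; have := r1e; rewrite {1}et !reflectionE -v2D r1v2 => h.
  have : (1 - 2 * t) *: (v2 - v) = 0.
    move/eqP: h; rewrite et -subr_eq0 => /eqP h; rewrite -[RHS]h.
    by apply/rowP => j; rewrite !mxE; ring.
  move=> /eqP; rewrite scaler_eq0 (subr_eq0 v2) (negPf v2v) orbF => /eqP t2.
  have -> : e = v + 2^-1 *: (v2 - v) by rewrite {1}et; congr (_ + _ *: _); lra.
  by apply/rowP => j; rewrite !mxE; field.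
have r1E : reflection n1 = reflection (v - e).
  rewrite v2D in v2v; rewrite (reflection_moved v2v) -v2D v2E.
  rewrite -(@reflection_scale _ (v - e) 2) //.
  congr reflection; by apply/rowP => j; rewrite !mxE; ring.
have r2e : reflection n2 e != e.
  apply/eqP => r2e; have := (fix2 i1).1 _ erefl; apply.
  have fx x : E x -> reflection n2 x = x.
    move=> /line[t ->]; rewrite v2E !reflectionE r2v r2e.
    by [].
  apply/seteqP; split=> [_ [x Ex <-]|x Ex]; first by rewrite fx.
  by exists x => //; exact: fx.
have r2v2 : reflection n2 v2 != v2.
  rewrite v2E !reflectionE r2v; apply: contra r2e => /eqP/addIr/scalerI h.
  by apply/eqP; apply: h.
have [[x0 Fx0] [a [c [aP FE]]]] := (fldim i2).1; rewrite -/F in FE Fx0.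
have aF x : F x -> dot a x = c by rewrite FE => -[].
have FI x : P x -> dot a x = c -> F x by move=> Px ac; rewrite FE.
have av := aF _ (EF _ Ev); have ae := aF _ (EF _ Ee).
have n2a : dot n2 a = 0.
  by apply: (dot_moved r2v2); rewrite (aF _ (EF _ Ev2)) (aF _ (stF2 _ (EF _ Ev2))).
have n2v := reflection_fixP n20 r2v.
have n3v := reflection_fixP n30 r3v; have n3e := reflection_fixP n30 r3e.
have ve : dot v e = 1 by rewrite dotC eE.
have v_gt1 : 1 < dot v v.
  have : 0 < dot (v - e) (v - e).
    rewrite dot_gt0 subr_eq0; apply: contra r2e => /eqP vee.
    by rewrite -vee r2v.
  by rewrite !dotE ee (dotC e) ve; lra.
(* As [e + n3] completes [v] and [e] to a frame, the vectors orthogonal to [v] and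
   [e] are multiples of [n3]. *)
have F3 : frame v e (e + n3).
  have n3n : 0 < dot n3 n3 by rewrite dot_gt0.
  split; rewrite // !dotE ?ee ?ve ?n3e ?(dotC v n3) ?n3v ?(dotC e n3) ?n3e; lra.
have par3 z : dot z v = 0 -> dot z e = 0 -> exists l, z = l *: n3.
  move=> zv ze; exists (dot z n3 / dot n3 n3); apply/eqP; rewrite -subr_eq0.
  apply/eqP; have n3n : dot n3 n3 != 0 by rewrite dot_eq0.
  by apply: (frame_ext F3); rewrite !dotE ?zv ?ze ?n3v ?n3e; field.
have not3 : ~ (forall x, F x -> F (reflection n3 x)).
  by move=> h; exact: (fix3 i2).1 (reflection_preservesP h) erefl.
(* If the plane of the face contained the origin, the third reflection would
   reverse its normal and preserve the face. *)
have c0 : c != 0.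
  apply/eqP => c0; have [l al] : exists l, a = l *: n3.
    by apply: par3; rewrite ?av ?ae.
  have r3a : reflection n3 a = - a.
    rewrite al reflectionZ /reflection mulfK ?dot_eq0 //.
    by rewrite scaler_nat mulr2n opprD addrA subrr add0r scalerN.
  apply: not3 => x Fx; apply: FI; first exact/stP3/FP.
  by rewrite -dot_reflectionl r3a dotNl aF // c0 oppr0.
have [f fD] : exists f, f = c^-1 *: a by exists (c^-1 *: a).
have fF x : F x -> dot f x = 1 by move=> Fx; rewrite fD dotZl aF // mulVf.
have Ff x : P x -> dot f x = 1 -> F x.
  move=> Px; rewrite fD dotZl => h; apply: FI => //.
  by apply: (mulfI (invr_neq0 c0)); rewrite h mulVf.
have fv := fF _ (EF _ Ev); have fe := fF _ (EF _ Ee).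
have [l fl_] : exists l, f - e = l *: n3.
  by apply: par3; rewrite dotDl dotNl ?fv ?fe ?ee ?(dotC e) ?ve subrr.
have l0 : l != 0.
  apply/eqP => l0; apply: not3 => x Fx; apply: Ff; first exact/stP3/FP.
  move/eqP: fl_; rewrite l0 scale0r subr_eq0 => /eqP fl_.
  by rewrite fl_ -dot_reflectionl r3e -fl_ fF.
have r3E : reflection n3 = reflection (f - e) by rewrite fl_ reflection_scale.
have Fr : frame v e f.
  split=> //; first by rewrite dotC.
  have : 0 < dot (f - e) (f - e).
    by rewrite dot_gt0 fl_ scaler_eq0 negb_or l0.
  by rewrite !dotE ee (dotC e f) fe; lra.
have r2E : reflection n2 = reflection (mirror v e f).
  have me0 : dot (mirror v e f) e != 0 by rewrite gt_eqF // mirror_e_gt0.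
  have n2E : n2 = (dot n2 e / dot (mirror v e f) e) *: mirror v e f.
    apply/eqP; rewrite -subr_eq0; apply/eqP.
    have mv := mirror_v Fr; have mf := mirror_f Fr.
    by apply: (frame_ext Fr); rewrite dotDl dotNl dotZl ?mv ?mf ?mulr0 ?subr0
      ?n2v ?divfK ?subrr // fD dotZr n2a mulr0.
  rewrite {1}n2E reflection_scale //; apply: contra n20 => /eqP h.
  by rewrite n2E h scale0r.
have stP n x : normals v e f n -> P x -> P (reflection n x).
  by move=> [->|->|->]; rewrite -?r1E -?r2E -?r3E; [exact: stP1|exact: stP2|exact: stP3].
have vertv : vertex P v by rewrite /vertex -fl0; exact: fldim ord0.
have fin : finite_set [set h (v + e + f) | h in reflection_group (normals v e f)].
  apply: (finite_orbit Fr (finite_vertex polyP) vertv) => n x Nn.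
  by apply: vertex_reflection => y; exact: stP.
have cpos : 0 < c.
  rewrite lt_def c0 leNgt /=; apply/negP => cneg.
  (* For negative [c] the polytope would lie beyond the plane of the face, but
     the orbit of [v] meets the chamber opposite to the one of the flag. *)
  have [h Gh [al [be [ga [al0 be0 ga0 hE]]]]] := chamber (- v) Fr fin.
  have Phv : P (h v).
    apply: (reflection_group_stable stP Gh).
    exact/FP/EF.
  have h1 : 1 <= dot f (h v).
    rewrite fD dotZl -(mulVf c0) ler_nM2l ?invr_lt0 //; exact: aP.
  have hvE : h v = - (h (- v)).
    by rewrite -[- v]scaleN1r (reflection_groupZ Gh) scaleN1r opprK.
  move: h1; rewrite hvE hE; have := frame_ff Fr; rewrite !dotE !(gram Fr).
  nra.
have fP x : P x -> dot f x <= 1.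
  by move=> Px; rewrite fD dotZl -(mulVf c0) ler_pM2l ?invr_gt0 //; exact: aP.
have eP x : P x -> dot e x <= 1.
  move=> Px; have f1 := fP _ Px; have f2 := fP _ (stP _ _ (Or33 _ _ erefl) Px).
  move: f2; rewrite -dot_reflectionl (reflect_v (frame_dual Fr)) !dotE; lra.
exists e, f; split=> //.
  split=> //.
  - move=> n y Nn Yy x Px; rewrite dot_reflectionl; apply: Yy; exact: stP.
  - exact/FP/EF.
  - exact/FP/EF.
  - by move=> x y Px Yy; rewrite dotC; exact: Yy.
have -> : [set x | P x /\ dot f x = 1] = F.
  by apply/seteqP; split=> [x [Px fx]|x Fx]; [exact: Ff|split; [exact: FP|exact: fF]].
exact: fldim i2.
Qed.

End Polytopes.

(** * Vertices and faces as orbits *)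

Section Vertices.
Variable R : realType.
Implicit Types (v e f a x y u g n : 'rV[R]_3) (P F E G : set 'rV[R]_3).

Lemma exposed_in_orbit v e f X Y g : dual_pair v e f X Y ->
  face Y [set g] -> vertex_orbit f e v g.
Proof.
move=> D [_ [a [c [aY gE]]]].
have [h Gh hmax] := max_in_orbit_f a D.
have Yhf := stableY D Gh (pair_f D).
have [Yg ag] : Y g /\ dot a g = c by have : [set g] g by []; rewrite {1}gE.
exists h; first by rewrite normals_dual.
have : [set g] (h f).
  rewrite gE; split=> //; apply/eqP; rewrite eq_le aY //= -ag; exact: hmax.
by [].
Qed.

Lemma vertex_orbit_vertex v e f P Y u : dual_pair v e f P Y ->
  vertex P v -> vertex_orbit v e f u -> vertex P u.
Proof.
move=> D Pv [h Gh <-]; apply: (reflection_group_stable _ Gh Pv) => n x Nn.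
by apply: vertex_reflection => y; exact: (pair_stableX D Nn).
Qed.

Lemma vertexE v e f P Y : dual_pair v e f P Y -> vertex P v ->
  vertex P = vertex_orbit v e f.
Proof.
move=> D Pv; apply/seteqP; split=> u; last exact: (vertex_orbit_vertex D Pv).
by case=> fu _; exact: exposed_in_orbit (pair_dual D) fu.
Qed.

Lemma omega_face v e f P p : dual_pair v e f P (polar P) -> vertex P v ->
  ([set u | vertex P u /\ (P u /\ dot f u = 1)] #= `I_p)%card ->
  omega R p = 4 * weight v f - 1.
Proof.
move=> D Pv cardp; apply: (weight_of_count D).
suff <- : [set u | vertex P u /\ (P u /\ dot f u = 1)]
    = [set u | vertex_orbit v e f u /\ dot f u = 1] by [].
rewrite (vertexE D Pv); apply/seteqP; split=> [u [Vu [_ fu]]|u [Vu fu]] //.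
by do 2?split=> //; exact: (vertex_orbitX D Vu).
Qed.

Lemma orbit_face v e f P g : dual_pair v e f P (polar P) ->
  face_of_dim P 2 [set x | P x /\ dot f x = 1] -> vertex_orbit f e v g ->
  face_of_dim P 2 [set x | P x /\ dot g x = 1].
Proof.
move=> D Pf [h Gh <-]; rewrite -(normals_dual v e f) in Gh.
pose S := [set g | face_of_dim P 2 [set x | P x /\ dot g x = 1]].
apply: (reflection_group_stable (A := S) _ Gh Pf) => n y Nn Sy.
have stP x : P x -> P (reflection n x) by exact: (pair_stableX D Nn).
rewrite /S /=; suff -> : [set x | P x /\ dot (reflection n y) x = 1] =
    reflection n @` [set x | P x /\ dot y x = 1].
  exact: face_of_dim_reflection.
apply/seteqP; split=> [x [Px yx]|_ [x [Px yx] <-]].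
  exists (reflection n x); last exact: reflectionK.
  by split; [exact: stP|rewrite -dot_reflectionl].
by split; [exact: stP|rewrite reflection_isom].
Qed.

Lemma face_of_dim2_proper P F : affine_dim P 3 -> affine_dim F 2 ->
  ~ (P `<=` F).
Proof.
move=> [y0 [B [Py0 fB PB _]]] [x0 [A [_ fA _ hull]]] PF.
have : (B <= A)%MS.
  apply/row_subP => i.
  have -> : row i B = (y0 + row i B - x0) - (y0 - x0).
    by rewrite opprB addrA subrK addrC addKr.
  by rewrite addmx_sub // ?eqmx_opp hull //; apply: PF.
by move=> /mxrankS; rewrite (eqP fA) (eqP fB).
Qed.

(** The sum of three affinely independent points of the face is a functional that
    is at most [3] on the polar, with equality only at the normal of the face; its
    maximum on the polar is in the orbit of [f]. *)
Lemma face_normal v e f P G : dual_pair v e f P (polar P) -> affine_dim P 3 ->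
  face_of_dim P 2 G ->
  exists2 g, vertex_orbit f e v g & G = [set x | P x /\ dot g x = 1].
Proof.
move=> D dimP [[[x1 Gx1] [a [c [aP GE]]]] dimG].
have [x0 [A [Gx0 fA GA hull]]] := dimG.
have a0 : a != 0.
  apply/eqP => a0; apply: (face_of_dim2_proper dimP dimG) => x Px.
  by move: Gx1; rewrite GE a0 => -[_ <-]; split; rewrite ?dot0l.
have c0 : 0 < c.
  have F := pair_frame D.
  have [h Gh [al [be [ga [al0 be0 ga0 hE]]]]] := chamber a F (pair_finite D).
  have [h' Gh' [hK _ adj]] := reflection_group_adjoint Gh.
  have : dot (h a) v <= c by rewrite adj aP //; exact: (stableX D Gh' (pair_v D)).
  rewrite hE !dotE !(gram F) => hc; have vv := frame_vv F.
  rewrite lt_def (le_trans _ hc) ?andbT; last by nra.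
  apply: contra a0 => /eqP c0.
  have [al_ be_ ga_] : [/\ al = 0, be = 0 & ga = 0] by split; nra.
  move: hE; rewrite al_ be_ ga_ !scale0r !addr0 => /(congr1 h'); rewrite hK => ->.
  by rewrite -(scale0r 0) (reflection_groupZ Gh') !scale0r.
pose g := c^-1 *: a.
have GEg : G = [set x | P x /\ dot g x = 1].
  rewrite GE; apply/seteqP; split=> x [Px ax]; split=> //.
    by rewrite dotZl ax mulVf // gt_eqF.
  by move: ax; rewrite dotZl => /(canRL (mulVKf (lt0r_neq0 c0))) ->; rewrite mulr1.
have Yg : polar P g.
  by move=> x Px; rewrite dotZl ler_pdivrMl // mulr1 aP.
have gG x : G x -> dot g x = 1 by rewrite GEg => -[].
have GP x : G x -> P x by rewrite GEg => -[].
exists g => //.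
pose b := x0 + \sum_i (x0 + row i A).
have [h Gh hmax] := max_in_orbit_f b D.
exists h; first by rewrite normals_dual.
have Yhf := stableY D Gh (pair_f D).
have := hmax g Yg; rewrite /b !big_ord_recl big_ord0 addr0.
rewrite !(dotDl x0) !(dotDl (x0 + _)) !(dotC _ g) !(dotC _ (h f)) !gG // => hle.
have i0 := Yhf _ (GP _ Gx0); have iA i := Yhf _ (GP _ (GA i)).
have j0 := iA ord0; have j1 := iA (lift ord0 ord0).
have k0 : dot (h f) x0 = 1 by lra.
apply: (@normal_unique R x0 A _ _ fA) => [|i||i]; [exact: gG|exact/gG/GA|exact: k0|].
have : i \in [:: ord0; lift ord0 ord0] by case: i => [[|[|]]].
by rewrite !inE => /orP[] /eqP ->; lra.
Qed.

Lemma omega_vertex v e f P q : dual_pair v e f P (polar P) -> affine_dim P 3 ->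
  face_of_dim P 2 [set x | P x /\ dot f x = 1] ->
  ([set F | face_of_dim P 2 F /\ F v] #= `I_q)%card ->
  omega R q = 4 * weight f v - 1.
Proof.
move=> D dimP Pf cardq; apply: (weight_of_count (pair_dual D)).
set O := [set g | _]; pose T g := [set x | P x /\ dot g x = 1].
apply: card_eq_trans cardq.
have -> : [set F | face_of_dim P 2 F /\ F v] = T @` O.
  apply/seteqP; split=> [F [dF Fv]|_ [g [Og vg] <-]].
    have [g Og FE] := face_normal D dimP dF; exists g => //; split=> //.
    by move: Fv; rewrite FE dotC => -[].
  split; first exact: (orbit_face D Pf Og).
  by split; [exact: pair_v D|rewrite dotC].
rewrite card_eq_sym; apply: inj_card_eq => g g'; rewrite !inE => -[Og vg] [Og' vg'].
move=> TT; have [_ [x0 [A [Tx0 fA TA _]]]] := orbit_face D Pf Og.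
have gT x : T g x -> dot g x = 1 by case.
have gT' x : T g x -> dot g' x = 1 by rewrite TT => -[].
by apply: (@normal_unique R x0 A _ _ fA) => [|i||i]; rewrite ?gT ?gT' //; exact: TA.
Qed.

End Vertices.

(** * Inversive coordinates *)

Section Inversive.
Variable R : realType.
Local Notation pvec := ('rV[R]_2 * R^o * R^o)%type.
Implicit Types (U V W N : pvec) (C : ocircle R) (x : extended_plane R) (y : 'rV[R]_2).

(** [((a, b), c)] stands for the function [2 * dot a y - c - b * dot y y] of the
    point [y]; for a circle, [b] is the bend and [a] the center scaled by it. The
    pairing is twice the Lorentz form. *)
Definition pairing U W : R :=
  2 * dot U.1.1 W.1.1 - U.1.2 * W.2 - W.1.2 * U.2.

Lemma pairingC U W : pairing U W = pairing W U.
Proof. by rewrite /pairing dotC; ring. Qed.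

Lemma pairingDl U V W : pairing (U + V) W = pairing U W + pairing V W.
Proof. by rewrite /pairing /= dotDl; ring. Qed.

Lemma pairingZl a U W : pairing (a *: U) W = a * pairing U W.
Proof. by rewrite /pairing /= dotZl /GRing.scale /=; ring. Qed.

Lemma pairingDr U V W : pairing U (V + W) = pairing U V + pairing U W.
Proof. by rewrite !(pairingC U) pairingDl. Qed.

Lemma pairingZr a U W : pairing U (a *: W) = a * pairing U W.
Proof. by rewrite !(pairingC U) pairingZl. Qed.

Lemma pairingNl U W : pairing (- U) W = - pairing U W.
Proof. by rewrite -scaleN1r pairingZl mulN1r. Qed.

Lemma pairingNr U W : pairing U (- W) = - pairing U W.
Proof. by rewrite !(pairingC U) pairingNl. Qed.

Definition pairingE :=
  (pairingDl, pairingDr, pairingNl, pairingNr, pairingZl, pairingZr).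

Definition preflection U W : pvec := W - pairing W U *: U.

Lemma pairing_preflection U V W :
  pairing (preflection U V) W = pairing V (preflection U W).
Proof. by rewrite /preflection !pairingE (pairingC U W); ring. Qed.

Lemma preflectionK U : pairing U U = 2 -> involutive (preflection U).
Proof.
move=> UU W; rewrite {1}/preflection /preflection !pairingE UU.
rewrite -addrA -opprD -scalerDl.
have -> : pairing W U + (pairing W U - pairing W U * 2) = 0 by ring.
by rewrite scale0r subr0.
Qed.

Lemma preflection_isom U V W : pairing U U = 2 ->
  pairing (preflection U V) (preflection U W) = pairing V W.
Proof. by move=> UU; rewrite pairing_preflection preflectionK. Qed.

Lemma preflection_lin U a V W :
  preflection U (a *: V + W) = a *: preflection U V + preflection U W.
Proof.
rewrite /preflection !pairingE scalerDl scalerBr scalerA opprD.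
by rewrite addrACA.
Qed.

Lemma preflectionZ U a W : preflection U (a *: W) = a *: preflection U W.
Proof. by rewrite /preflection pairingZl scalerBr scalerA. Qed.

(** Points of the extended plane as rays of the light cone. *)
Definition point_vec x : pvec :=
  if x is Some y then (y, 1, dot y y) else (0, 0, 1).

Definition region_of U : set (extended_plane R) :=
  [set x | 0 <= pairing (point_vec x) U].

Definition circle_vec C : pvec :=
  match C with
  | Round c r _ => (r^-1 *: c, r^-1, r^-1 * dot c c - r)
  | Line n d _ => (n, 0, 2 * d)
  end.

Lemma circle_vec_unit C : pairing (circle_vec C) (circle_vec C) = 2.
Proof.
case: C => [c r r0|n d nn]; rewrite /pairing /= ?dotE ?nn; last by ring.
by field.
Qed.

Lemma bend_vec C : bend C = (circle_vec C).1.2.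
Proof. by case: C. Qed.

Lemma regionE C : region C = region_of (circle_vec C).
Proof.
apply/funext => x; apply/propext.
case: C x => [c r r0|n d nn] [y|]; rewrite /region_of /pairing /=; last first.
- by rewrite dot0l; split=> // _; lra.
- by rewrite dotC; split; lra.
- by rewrite dot0l mulr0 mul0r subr0 sub0r mulr1 oppr_ge0 invr_le0 le_eqVlt (negPf r0).
have -> : 2 * dot y (r^-1 *: c) - 1 * (r^-1 * dot c c - r) - r^-1 * dot y y
    = r^-1 * (r ^+ 2 - dot (y - c) (y - c)).
  by rewrite !dotE (dotC c y); field.
case: ifP => [r_gt0|/negbT r_le0].
  by rewrite pmulr_rge0 ?invr_gt0 // subr_ge0.
rewrite nmulr_rge0 ?subr_le0 // invr_lt0 lt_neqAle r0.
by rewrite leNgt.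
Qed.

Lemma circle_of_vec U : pairing U U = 2 -> exists C, circle_vec C = U.
Proof.
case: U => [[a b] c]; rewrite /pairing /= => h.
have [b0|b0] := eqVneq (b : R) 0.
  have aa : dot a a = 1 by move: h; rewrite b0; lra.
  exists (Line (c / 2) aa); rewrite /= b0; congr (_, _, _).
  by rewrite mulrC divfK.
exists (@Round R (b^-1 *: a) b^-1 (invr_neq0 b0)) => /=.
rewrite invrK scalerA mulfV // scale1r; congr (_, _, _).
rewrite !dotE; have -> : dot a a = 1 + (b : R) * c by lra.
by field.
Qed.

Lemma point_vec_inj l x x' : 0 < l -> point_vec x = l *: point_vec x' -> x = x'.
Proof.
move=> l0; case: x x' => [y|] [y'|] //=; case.
- rewrite /GRing.scale /= mulr1 => h1 h2 _; move: h1.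
  by rewrite -h2 => ->; congr Some; apply/rowP => i; rewrite !mxE mul1r.
- by move=> _ /eqP; rewrite /GRing.scale /= mulr0 oner_eq0.
- by move=> _ /eqP; rewrite /GRing.scale /= mulr1 eq_sym (gt_eqF l0).
Qed.

Lemma scale_subE (l k : R) U W : l *: (W - k *: U) =
  (l *: (W.1.1 - k *: U.1.1), l * (W.1.2 - k * U.1.2), l * (W.2 - k * U.2)).
Proof. by []. Qed.

(** The scalar is positive, so that it does not change the side of a circle on
    which a point lies. *)
Lemma inversion_point_vec C x : exists2 l, 0 < l &
  point_vec (circle_inversion C x) = l *: preflection (circle_vec C) (point_vec x).
Proof.
rewrite /preflection; case: C x => [c r r0|n d nn] [y|];
  rewrite /circle_inversion; last first.
- exists 1 => //; rewrite scale_subE /pairing /= dot0l.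
  by congr (_, _, _); [apply/rowP => i; rewrite !mxE|..]; ring.
- exists 1 => //; rewrite scale_subE /pairing /=.
  congr (_, _, _); [apply/rowP => i; rewrite !mxE (dotC n)|..]; try ring.
  by rewrite !dotE nn (dotC n y); ring.
- exists (r ^+ 2); first by rewrite exprn_even_gt0.
  rewrite scale_subE /pairing /= dot0l.
  by congr (_, _, _); [apply/rowP => i; rewrite !mxE|..]; field.
have [->|yc] := eqVneq y c.
  exists (r ^+ 2)^-1; first by rewrite invr_gt0 exprn_even_gt0.
  rewrite scale_subE /pairing /= !dotE.
  congr (_, _, _); [apply/rowP => i; rewrite !mxE|..]; by field.
have D0 : 0 < dot (y - c) (y - c) by rewrite dot_gt0 subr_eq0.
exists (r ^+ 2 / dot (y - c) (y - c)).
  by rewrite divr_gt0 // exprn_even_gt0.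
rewrite scale_subE /pairing /=; move: D0.
have -> : dot (y - c) (y - c) = dot y y - 2 * dot y c + dot c c.
  by rewrite !dotE (dotC c y); ring.
rewrite !dotE (dotC c y) => D0.
congr (_, _, _); [apply/rowP => i; rewrite !mxE|..]; field; by rewrite r0 gt_eqF.
Qed.

Lemma circle_inversionK C : involutive (circle_inversion C).
Proof.
move=> x; have [l l0 lE] := inversion_point_vec C x.
have [k k0 kE] := inversion_point_vec C (circle_inversion C x).
apply: (@point_vec_inj (k * l)); first exact: mulr_gt0.
by rewrite kE lE preflectionZ preflectionK ?circle_vec_unit // scalerA.
Qed.

Lemma inversion_region_of C W :
  circle_inversion C @` region_of W = region_of (preflection (circle_vec C) W).
Proof.
have pos x : region_of W (circle_inversion C x)
    = region_of (preflection (circle_vec C) W) x.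
  have [l l0 lE] := inversion_point_vec C x.
  by rewrite /region_of /= lE pairingZl pmulr_rge0 // pairing_preflection.
apply/seteqP; split=> [_ [x Wx <-]|x].
  by rewrite -pos circle_inversionK.
by rewrite -pos => Wx; exists (circle_inversion C x); rewrite ?circle_inversionK.
Qed.

Lemma region_of_scale (l : R) U : 0 < l -> region_of (l *: U) = region_of U.
Proof.
by move=> l0; apply/funext => x; rewrite /region_of /= pairingZr pmulr_rge0.
Qed.

(** The last clause provides the adjoint of [M], through which a coordinate of
    [M W] is read off as a pairing with [W]. *)
Lemma moebius_isometry mu : moebius mu -> exists M : pvec -> pvec,
  [/\ forall a U V, M (a *: U + V) = a *: M U + M V,
      forall U V, pairing (M U) (M V) = pairing U V,
      forall W, mu @` region_of W = region_of (M W)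
    & forall N, exists2 N', pairing N' N' = pairing N N &
        forall W, pairing (M W) N = pairing W N'].
Proof.
elim=> [|C f _ _ [M [lin isom act adj]]].
  by exists id; split=> // [W|N]; [rewrite image_id|exists N].
have UU := circle_vec_unit C.
exists (preflection (circle_vec C) \o M); split=> [a U V|U V|W|N] /=.
- by rewrite lin preflection_lin.
- by rewrite preflection_isom.
- by rewrite -inversion_region_of -act image_comp.
- have [N' N'N' h] := adj (preflection (circle_vec C) N).
  exists N'; first by rewrite N'N' preflection_isom.
  by move=> W; rewrite pairing_preflection h.
Qed.

(** A boundary point [y] of [region_of U] belongs to [region_of V]. If it were an
    interior point there, a small step along the outer normal [g] of the boundary
    would stay in [region_of V], but it leaves [region_of U]. *)
Lemma region_of_boundary U V y : pairing U U = 2 -> region_of U = region_of V ->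
  pairing (point_vec (Some y)) U = 0 -> pairing (point_vec (Some y)) V = 0.
Proof.
case: U V => [[a b] c] [[a' b'] c'] UU UV py.
have py' : 0 <= pairing (point_vec (Some y)) (a', b', c').
  by have : region_of (a', b', c') (Some y) by rewrite -UV /region_of /= py.
apply/eqP; rewrite eq_le py' andbT leNgt; apply/negP => d0.
move: UU py d0; rewrite /pairing /= !mul1r => UU py d0.
set d := 2 * dot y a' - c' - (b' : R) * dot y y in d0.
have [g gD] : exists g, g = (b : R) *: y - a by eexists.
have gg : dot g g = 1.
  have -> : dot g g = (b : R) * (b * dot y y - 2 * dot y a) + dot a a.
    by rewrite gD !dotE (dotC a y); ring.
  have -> : (b : R) * dot y y - 2 * dot y a = - c by lra.
  by lra.
pose K : R := 2 * dot g a' - 2 * b' * dot y g.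
pose s : R := d * (1 + `|b : R|) + `|K| + `|b' : R|.
have s_gt0 : 0 < s.
  by rewrite /s -addrA ltr_wpDr ?addr_ge0 // mulr_gt0 // ltr_pwDl.
(* A step [ep] that is short enough for the first-order terms to decide. *)
pose ep := d / s.
have ep0 : 0 < ep by rewrite divr_gt0.
have epE : ep * s = d by rewrite divfK // gt_eqF.
have b_ge0 := normr_ge0 (b : R); have K_ge0 := normr_ge0 K.
have b'_ge0 := normr_ge0 (b' : R).
have ep1 : ep <= 1.
  rewrite ler_pdivrMr // mul1r /s; nra.
have epb : ep * `|b : R| < 1.
  rewrite /ep mulrAC ltr_pdivrMr // mul1r /s; nra.
have nb := ler_norm (- b : R); rewrite normrN in nb.
have nK := ler_norm (- K); rewrite normrN in nK.
have nb' := ler_norm (b' : R).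
have : ~ region_of (a, b, c) (Some (y + ep *: g)).
  apply/negP; rewrite /region_of /= -ltNge /pairing /= mul1r !dotE (dotC g y) gg.
  have -> : 2 * (dot y a + ep * dot g a) - c -
     b * (dot y y + ep * dot y g + (ep * dot y g + ep * (ep * 1)))
     = (2 * dot y a - c - b * dot y y) - 2 * ep * dot g (b *: y - a) - b * ep ^+ 2 :> R.
    by rewrite !dotE (dotC g y); ring.
  rewrite py -gD gg; nra.
rewrite UV /region_of /= => /negP; rewrite -ltNge /pairing /= mul1r !dotE (dotC g y) gg.
have -> : 2 * (dot y a' + ep * dot g a') - c' -
     b' * (dot y y + ep * dot y g + (ep * dot y g + ep * (ep * 1)))
     = d + ep * K - b' * ep ^+ 2 :> R.
  by rewrite /d /K; ring.
have h1 : - (ep * `|K|) <= ep * K.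
  by rewrite -mulrN ler_pM2l // lerNl.
have h2 : b' * ep ^+ 2 <= ep * `|b' : R|.
  rewrite mulrC expr2 -mulrA ler_pM2l //; nra.
have h3 : 0 < ep * (d * (1 + `|b : R|)) by do 2!rewrite mulr_gt0 //; lra.
move: epE; rewrite /s; lra.
Qed.

(** The boundary circle of [region_of U], on which both functions vanish, shows
    that [V] is proportional to [U]; the point at infinity excludes [- U]. *)
Lemma region_of_inj_bend U V : pairing U U = 2 -> pairing V V = 2 ->
  region_of U = region_of V -> U.1.2 != 0 -> U = V.
Proof.
move=> UU VV UV; have bd y := region_of_boundary UU UV (y := y).
have oo : region_of U None <-> region_of V None by rewrite UV.
case: U V UU VV UV bd oo => [[a b] c] [[a' b'] c'] /= UU VV UV bd oo b0.
have b0' : (b : R) != 0 by [].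
move: UU VV; rewrite {1 2}/pairing /= => UU VV.
(* The points [(a + g) / b], with [g] a unit vector, form the boundary circle. *)
have E g : dot g g = 1 ->
    2 * dot a' (a + g) / b - c' - b' * (dot a a + 2 * dot a g + 1) / b ^+ 2 = 0 :> R.
  move=> gg; have := bd ((b : R)^-1 *: (a + g)).
  rewrite /pairing /= !dotE gg (dotC g a) mul1r => h.
  rewrite -[RHS]h; first by rewrite (dotC g a'); rewrite (dotC a a'); field.
  have -> : (c : R) = (dot a a - 1) / b; last by field.
  by apply: (mulIf b0'); rewrite divfK //; lra.
have odd g : dot g g = 1 -> dot ((b : R) *: a' - (b' : R) *: a) g = 0.
  move=> gg; have Ng : dot (- g) (- g) = 1 by rewrite !dotE opprK.
  have := E _ Ng; have := E _ gg; rewrite !dotE => e1 e2.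
  have : (2 * (dot a' a + dot a' g) / b - c' - b' * (dot a a + 2 * dot a g + 1) / b ^+ 2)
     - (2 * (dot a' a - dot a' g) / b - c' - b' * (dot a a + 2 * - dot a g + 1) / b ^+ 2)
     = 4 / b ^+ 2 * (b * dot a' g - b' * dot a g) :> R by field.
  rewrite e1 e2 subrr => /esym/eqP; rewrite mulf_eq0 => /orP[|/eqP //].
  by rewrite mulf_eq0 pnatr_eq0 invr_eq0 expf_eq0 (negPf b0') andbF.
have aE : (b : R) *: a' = (b' : R) *: a.
  apply/eqP; rewrite -subr_eq0; set d := _ - _ in odd *; apply/negPn/negP => d0.
  have dd : 0 < dot d d by rewrite dot_gt0.
  have /odd : dot ((Num.sqrt (dot d d))^-1 *: d) ((Num.sqrt (dot d d))^-1 *: d) = 1.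
    rewrite dotZl dotZr mulrA -expr2 exprVn sqr_sqrtr ?ltW //.
    by rewrite mulVf // gt_eqF.
  rewrite dotZr => /eqP; rewrite mulf_eq0 invr_eq0 sqrtr_eq0 (gt_eqF dd).
  by rewrite leNgt dd.
have a'E : a' = (b' / b) *: a.
  by rewrite mulrC -scalerA -aE scalerA mulVf // scale1r.
have e0 : dot (delta_mx 0 0 : 'rV[R]_2) (delta_mx 0 0) = 1.
  rewrite /dot (bigD1 0) //= big1 => [|j /negPf j0]; first by rewrite !mxE /= addr0 mulr1.
  by rewrite !mxE j0 andbF mulr0.
have c'E : c' = b' / b * c.
  have := E _ e0; rewrite a'E dotDr !dotZl => h.
  have -> : (c : R) = (dot a a - 1) / b by apply: (mulIf b0'); rewrite divfK //; lra.
  rewrite -[RHS]subr0 -h; field.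
  exact: b0'.
have r1 : (b' / b) ^+ 2 = 1 :> R.
  have : 2 * dot a' a' - b' * c' - b' * c'
      = (b' / b) ^+ 2 * (2 * dot a a - b * c - b * c) :> R.
    by rewrite a'E c'E !dotE; field.
  by rewrite VV UU => h; lra.
have bE : b' = b.
  have /eqP := r1; rewrite -subr_eq0 -[1](expr1n _ 2) subr_sqr mulf_eq0.
  case/orP => /eqP h; first by apply: (mulIf (invr_neq0 b0')); rewrite mulfV //; lra.
  have bb : b' = - b :> R by apply: (mulIf (invr_neq0 b0')); rewrite mulNr mulfV //; lra.
  move: oo; rewrite /region_of /pairing /= !dot0l mulr0 !mul0r subr0 !mulr1 !sub0r.
  rewrite bb opprK oppr_ge0 => oo.
  have [bn|bp] := leP (b : R) 0; first by have := oo.1 bn => bn'; lra.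
  by have := oo.2 (ltW bp); lra.
by rewrite a'E c'E bE mulfV // scale1r mul1r.
Qed.

Lemma region_of_inj U V : pairing U U = 2 -> pairing V V = 2 ->
  region_of U = region_of V -> U = V.
Proof.
move=> UU VV UV.
have [Ub|Ub] := eqVneq U.1.2 0; last exact: region_of_inj_bend UV Ub.
have [Vb|Vb] := eqVneq V.1.2 0; last by rewrite (region_of_inj_bend VV UU (esym UV) Vb).
have bd y := region_of_boundary UU UV (y := y).
have mem y : region_of U (Some y) <-> region_of V (Some y) by rewrite UV.
case: U V UU VV UV Ub Vb bd mem => [[a b] c] [[a' b'] c'] /= UU VV _ b0 b'0 bd mem.
move: UU VV bd mem; rewrite b0 b'0 /region_of /pairing /= => UU VV bd mem.
have aa : dot a a = 1 by lra.
have aa' : dot a' a' = 1 by lra.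
(* When both boundaries are lines, the first one is the set of these points. *)
have E z : 2 * dot (((c : R) / 2 - dot z a) *: a + z) a' - c' = 0 :> R.
  have := bd (((c : R) / 2 - dot z a) *: a + z).
  rewrite !mul0r !subr0 !mul1r; apply.
  by rewrite !dotE aa; field.
have := E 0; rewrite addr0 dot0l subr0 dotZl => E0.
have := E a'; rewrite dotDl dotZl aa' (dotC a' a) => E1.
have : (dot a a' - 1) * (dot a a' + 1) = 0 by move: E0 E1; lra.
move=> /eqP; rewrite mulf_eq0 => /orP[] /eqP h.
  have a'E : a' = a.
    apply/eqP; rewrite -subr_eq0 -dot_eq0 !dotE (dotC a' a) aa aa'.
    by apply/eqP; lra.
  by rewrite a'E; congr (_, _, _); move: E0; rewrite a'E aa; lra.
have := (mem (((c : R) / 2 + 1) *: a)).1.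
rewrite !mul0r !subr0 !mul1r !dotZl aa => /(_ _) m.
have : 0 <= 2 * (((c : R) / 2 + 1) * dot a a') - c' by apply: m; lra.
have aN : dot a a' = -1 by lra.
by move: E0; rewrite aN => E0 m'; exfalso; lra.
Qed.

End Inversive.

(** * Stereographic projection *)

Section Stereographic.
Variable R : realType.
Local Notation pvec := ('rV[R]_2 * R^o * R^o)%type.
Implicit Types (u v w : 'rV[R]_3) (y : 'rV[R]_2) (x : extended_plane R).

Definition planar u : 'rV[R]_2 := \row_j u 0 (lift ord_max j).

Definition space y (h : R) : 'rV[R]_3 :=
  \row_i if unlift ord_max i is Some j then y 0 j else h.

Lemma planar_space y h : planar (space y h) = y.
Proof. by apply/rowP => j; rewrite !mxE liftK. Qed.

Lemma space_max y h : space y h 0 ord_max = h.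
Proof. by rewrite mxE unlift_none. Qed.

Lemma dot_planar u v :
  dot u v = dot (planar u) (planar v) + u 0 ord_max * v 0 ord_max.
Proof.
rewrite /dot (bigD1_ord ord_max) //= addrC; congr (_ + _).
by apply: eq_bigr => j _; rewrite !mxE.
Qed.

(** The image under stereographic projection of the half-space [t <= dot _ v], in
    inversive coordinates, up to a positive scalar. *)
Definition cap_vec v (t : R) : pvec := (planar v, t - v 0 ord_max, t + v 0 ord_max).

Lemma pairing_cap v t w s :
  pairing (cap_vec v t) (cap_vec w s) = 2 * (dot v w - t * s).
Proof. by rewrite /pairing dot_planar /=; ring. Qed.

Lemma cap_vec_lin a v t w s :
  cap_vec (a *: v + w) (a * t + s) = a *: cap_vec v t + cap_vec w s.
Proof.
apply/esym; rewrite /cap_vec; congr (_, _, _).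
- by apply/rowP => j; rewrite !mxE.
- by rewrite /= !mxE /GRing.scale /=; ring.
- by rewrite /= !mxE /GRing.scale /=; ring.
Qed.

Lemma stereographic_vec u : sphere u ->
  exists2 l, 0 < l & point_vec (stereographic u) = l *: cap_vec u 1.
Proof.
rewrite /sphere /= dot_planar /stereographic => uu; case: eqP => [u1|/eqP u1].
  exists 2^-1; first by rewrite invr_gt0.
  have p0 : planar u = 0.
    by apply/eqP; rewrite -dot_eq0; apply/eqP; move: uu; rewrite u1; lra.
  rewrite /cap_vec p0 u1; congr (_, _, _); first by rewrite scaler0.
    by rewrite subrr scaler0.
  by rewrite /GRing.scale /= mulVf.
have pp : dot (planar u) (planar u) = 1 - u 0 ord_max ^+ 2 by lra.
have u1' : 1 - u 0 ord_max != 0 by rewrite subr_eq0 eq_sym.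
exists (1 - u 0 ord_max)^-1.
  have := dot_ge0 (planar u); rewrite pp => p0.
  by rewrite invr_gt0 lt_def u1' /=; nra.
have -> : (\row_j (u 0 (lift ord_max j) / (1 - u 0 ord_max)))
    = (1 - u 0 ord_max)^-1 *: planar u.
  by apply/rowP => j; rewrite !mxE mulrC.
rewrite /cap_vec /=; congr (_, _, _); first by rewrite /GRing.scale /= mulVf.
by rewrite !dotE pp /GRing.scale /=; field.
Qed.

Lemma stereographic_onto x : exists2 u, sphere u & stereographic u = x.
Proof.
case: x => [y|]; last first.
  exists (space 0 1).
    by rewrite /sphere /= dot_planar planar_space space_max dot0l; ring.
  by rewrite /stereographic space_max eqxx.
have D0 : 0 < dot y y + 1 by rewrite ltr_wpDl // dot_ge0.
have D1 := lt0r_neq0 D0.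
exists (space ((2 / (dot y y + 1)) *: y) ((dot y y - 1) / (dot y y + 1))).
  by rewrite /sphere /= dot_planar planar_space space_max !dotE; field.
have -> : stereographic (space ((2 / (dot y y + 1)) *: y)
   ((dot y y - 1) / (dot y y + 1))) = Some (\row_j (space ((2 / (dot y y + 1)) *: y)
     ((dot y y - 1) / (dot y y + 1)) 0 (lift ord_max j)
     / (1 - (dot y y - 1) / (dot y y + 1)))).
  rewrite /stereographic space_max ifF //; apply/negbTE/eqP.
  by move=> /(congr1 ( *%R^~ (dot y y + 1))); rewrite divfK // => h; lra.
congr Some; apply/rowP => j; rewrite !mxE liftK mxE.
have -> : 1 - (dot y y - 1) / (dot y y + 1) = 2 / (dot y y + 1) by field.
by field.
Qed.

Lemma stereographic_circleE v : stereographic_circle v = region_of (cap_vec v 1).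
Proof.
apply/seteqP; split=> [_ [u [uS uv] <-]|x hx].
  have [l l0 lE] := stereographic_vec uS.
  by rewrite /region_of /= lE pairingZl pairing_cap pmulr_rge0 //; lra.
have [u uS ux] := stereographic_onto x; exists u => //; split=> //.
have [l l0 lE] := stereographic_vec uS.
by move: hx; rewrite /region_of /= -ux lE pairingZl pairing_cap pmulr_rge0 //; lra.
Qed.

End Stereographic.

(** * The lattice of a fundamental basis *)

Section Lattice.
Variable R : realType.
Local Notation lvec := ('rV[R]_3 * R^o)%type.

Definition subring (Z : set R) : Prop :=
  [/\ Z 1, forall a b, Z a -> Z b -> Z (a - b) & forall a b, Z a -> Z b -> Z (a * b)].

Variables (Z : set R) (Zring : subring Z).

Let Z1 : Z 1. Proof. by case: Zring. Qed.
Let ZB a b : Z a -> Z b -> Z (a - b). Proof. by case: Zring => _ h _; exact: h. Qed.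
Let ZM a b : Z a -> Z b -> Z (a * b). Proof. by case: Zring => _ _; exact. Qed.

Lemma subring0 : Z 0. Proof. by rewrite -(subrr 1); exact: ZB. Qed.
Let Z0 := subring0.

Lemma subringN a : Z a -> Z (- a). Proof. by rewrite -sub0r; exact: ZB. Qed.
Let ZN := subringN.

Lemma subringD a b : Z a -> Z b -> Z (a + b).
Proof. by move=> Za Zb; rewrite -[b]opprK; apply: ZB => //; exact: ZN. Qed.
Let ZD := subringD.

Lemma subring2 : Z 2. Proof. by rewrite -[2]/(1 + 1); exact: ZD. Qed.
Let Z2 := subring2.

Ltac in_subring := repeat first
  [assumption | exact Z1 | exact Z0 | exact Z2 | apply: ZD | apply: ZN | apply: ZM].

(** The Lorentz form. *)
Definition lor (U W : lvec) : R := dot U.1 W.1 - U.2 * W.2.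

Definition lift_reflection (n : 'rV[R]_3) (W : lvec) : lvec := (reflection n W.1, W.2).

(** The Lorentz reflection along [(g, 1)], which is the inversion in the circle of
    the polar vertex [g]. *)
Definition cap_reflection (g : 'rV[R]_3) (W : lvec) : lvec :=
  W - (2 * (dot W.1 g - W.2) / (dot g g - 1)) *: (g, 1).

Lemma lift_reflection_lin n a U W :
  lift_reflection n (a *: U + W) = a *: lift_reflection n U + lift_reflection n W.
Proof. by rewrite /lift_reflection /= !reflectionE. Qed.

Lemma cap_reflection_lin g a U W :
  cap_reflection g (a *: U + W) = a *: cap_reflection g U + cap_reflection g W.
Proof.
rewrite /cap_reflection scalerBr scalerA addrACA -opprD -scalerDl.
congr (_ - _ *: _); rewrite /= !dotE /GRing.scale /=; ring.
Qed.

Lemma cap_reflection_lor g W : dot g g != 1 ->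
  lor (cap_reflection g W) (cap_reflection g W) = lor W W.
Proof.
move=> gg; rewrite /lor /cap_reflection /= !dotE (dotC g W.1) /GRing.scale /=.
by field; rewrite subr_eq0.
Qed.

Lemma lift_cap_reflection n g W :
  lift_reflection n (cap_reflection g W) =
    cap_reflection (reflection n g) (lift_reflection n W).
Proof.
by rewrite /lift_reflection /cap_reflection /= !reflectionE !reflection_isom.
Qed.

Lemma lift_reflectionK n : involutive (lift_reflection n).
Proof. by case=> w t; rewrite /lift_reflection /= reflectionK. Qed.

Variables (v e f : 'rV[R]_3) (F : frame v e f).
Variables (x y : R) (xE : x = 4 * weight v f - 1) (yE : y = 4 * weight f v - 1).
Hypotheses (Zx : Z x) (Zy : Z y).

Definition comb (a b c t : R) : lvec := (a *: v + b *: e + c *: f, t).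

Lemma combE a b c t a' b' c' t' :
  [/\ a = a', b = b', c = c' & t = t'] -> comb a b c t = comb a' b' c' t'.
Proof. by case=> -> -> -> ->. Qed.

Lemma comb_lin k a b c t a' b' c' t' :
  k *: comb a b c t + comb a' b' c' t' =
    comb (k * a + a') (k * b + b') (k * c + c') (k * t + t').
Proof.
rewrite /comb; apply/esym; congr (_, _).
by apply/rowP => i; rewrite !mxE; ring.
Qed.

Lemma comb_v a b c t :
  lift_reflection (v - e) (comb a b c t) = comb (- a) (b + 2 * a) c t.
Proof.
rewrite /comb /lift_reflection /= !reflectionE (reflect_v F) (reflect_v_e F).
rewrite (reflect_v_f F); congr (_, _); apply/rowP => i; rewrite !mxE; ring.
Qed.

Lemma comb_f a b c t :
  lift_reflection (f - e) (comb a b c t) = comb a (b + 2 * c) (- c) t.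
Proof.
rewrite /comb /lift_reflection /= !reflectionE (reflect_v (frame_dual F)).
rewrite (reflect_v_e (frame_dual F)) (reflect_v_f (frame_dual F)).
congr (_, _); apply/rowP => i; rewrite !mxE; ring.
Qed.

Lemma comb_e a b c t : lift_reflection (mirror v e f) (comb a b c t) =
  comb (a + b * (1 + x) / 2) (- b) (c + b * (1 + y) / 2) t.
Proof.
rewrite /comb /lift_reflection /= !reflectionE (reflect_e F) (reflect_e_v F).
rewrite (reflect_e_f F) xE yE; congr (_, _); apply/rowP => i; rewrite !mxE; by field.
Qed.

(** The vectors [(vi, 1)] of the fundamental basis; the coefficients come from
    [basis2E], [basis3E] and [basis4E]. *)
Definition basis1 := comb 1 0 0 1.
Definition basis2 := comb (- 1) 2 0 1.
Definition basis3 := comb (- x) (2 * (x - 1)) (1 + y) 1.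
Definition basis4 := comb (- (x * x + x * y + y)) (2 * (x * x + x * y - x))
                      ((1 + y) * (x + y - 1)) 1.

Lemma basis2E : basis2 = lift_reflection (v - e) basis1.
Proof. by rewrite /basis1 comb_v; apply: combE; split; ring. Qed.

Lemma basis3E : basis3 = lift_reflection (v - e) (lift_reflection (mirror v e f) basis2).
Proof. by rewrite /basis2 comb_e comb_v; apply: combE; split; field. Qed.

Lemma basis4E : basis4 = lift_reflection (v - e) (lift_reflection (mirror v e f)
                   (lift_reflection (f - e) basis3)).
Proof. by rewrite /basis3 comb_f comb_e comb_v; apply: combE; split; field. Qed.

Definition lattice : set lvec := [set W | exists c1 c2 c3 c4,
  [/\ Z c1, Z c2, Z c3, Z c4
    & W = c1 *: basis1 + (c2 *: basis2 + (c3 *: basis3 + c4 *: basis4))]].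

Lemma lattice_lin k U W : Z k -> lattice U -> lattice W -> lattice (k *: U + W).
Proof.
move=> Zk [a1 [a2 [a3 [a4 [h1 h2 h3 h4 ->]]]]] [c1 [c2 [c3 [c4 [k1 k2 k3 k4 ->]]]]].
exists (k * a1 + c1), (k * a2 + c2), (k * a3 + c3), (k * a4 + c4).
split; in_subring.
rewrite !scalerDr !scalerA addrACA -scalerDl; congr (_ + _).
rewrite addrACA -scalerDl; congr (_ + _).
by rewrite addrACA -!scalerDl.
Qed.

Lemma lattice0 : lattice 0.
Proof. by exists 0, 0, 0, 0; split=> //; rewrite !scale0r !addr0. Qed.

Lemma lattice_comb c1 c2 c3 c4 a b c t : Z c1 -> Z c2 -> Z c3 -> Z c4 ->
  [/\ a = c1 - c2 - c3 * x - c4 * (x * x + x * y + y),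
      b = 2 * c2 + 2 * c3 * (x - 1) + 2 * c4 * (x * x + x * y - x),
      c = (1 + y) * (c3 + c4 * (x + y - 1)) & t = c1 + c2 + c3 + c4] ->
  lattice (comb a b c t).
Proof.
move=> Zc1 Zc2 Zc3 Zc4 [-> -> -> ->]; exists c1, c2, c3, c4; split=> //.
rewrite -[c4 *: basis4]addr0; have -> : (0 : lvec) = comb 0 0 0 0.
  by rewrite /comb !scale0r !addr0.
by rewrite !comb_lin; apply: combE; split; ring.
Qed.

Lemma lattice_stable (phi : lvec -> lvec) :
  (forall a U W, phi (a *: U + W) = a *: phi U + phi W) ->
  lattice (phi basis1) -> lattice (phi basis2) ->
  lattice (phi basis3) -> lattice (phi basis4) ->
  forall W, lattice W -> lattice (phi W).
Proof.
move=> lin h1 h2 h3 h4 _ [c1 [c2 [c3 [c4 [k1 k2 k3 k4 ->]]]]].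
have phi0 : phi 0 = 0.
  have /(congr1 (fun z => z - phi 0)) := lin 1 0 0.
  by rewrite !scale1r addr0 addrK subrr => <-.
rewrite -[c4 *: basis4]addr0 !lin phi0.
by do 4!apply: lattice_lin => //; exact: lattice0.
Qed.

(** Although the second reflection has coefficients [(1 + x) / 2] and [(1 + y) / 2]
    on [v], [e] and [f], the matrices of the three reflections in the fundamental
    basis are polynomial in [x] and [y]. *)
Lemma lattice_reflection n W : normals v e f n -> lattice W ->
  lattice (lift_reflection n W).
Proof.
move=> Nn; apply: lattice_stable W; first exact: lift_reflection_lin.
- case: Nn => ->; rewrite /basis1 ?comb_v ?comb_e ?comb_f.
  + by apply: (@lattice_comb 0 1 0 0) => //; split; ring.
  + by apply: (@lattice_comb 1 0 0 0) => //; split; field.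
  + by apply: (@lattice_comb 1 0 0 0) => //; split; ring.
- case: Nn => ->; rewrite /basis2 ?comb_v ?comb_e ?comb_f.
  + by apply: (@lattice_comb 1 0 0 0) => //; split; ring.
  + by apply: (@lattice_comb x (- x) 1 0); in_subring; split; field.
  + by apply: (@lattice_comb 0 1 0 0) => //; split; ring.
- case: Nn => ->; rewrite /basis3 ?comb_v ?comb_e ?comb_f.
  + by apply: (@lattice_comb x (- x) 1 0); in_subring; split; ring.
  + by apply: (@lattice_comb (x * x - x) (1 - x * x) x 0); in_subring; split; field.
  + by apply: (@lattice_comb y x (- (x + y)) 1); in_subring; split; ring.
- case: Nn => ->; rewrite /basis4 ?comb_v ?comb_e ?comb_f.
  + by apply: (@lattice_comb (x * x + x * y + y) (- (x * x + x * y + y)) 0 1);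
      in_subring; split; ring.
  + by apply: (@lattice_comb (x * x * (x + y - 1)) (x - x * y - x * x * (x + y))
      (x * (x + y - 1)) 1); in_subring; split; field.
  + by apply: (@lattice_comb (y * (x + y - 1)) (x * (x + y - 1))
      (1 - (x + y) * (x + y)) (x + y)); in_subring; split; ring.
Qed.

Lemma cap_reflection_fix w : dot w f = 1 -> cap_reflection f (w, 1) = (w, 1).
Proof.
by move=> wf; rewrite /cap_reflection /= wf subrr mulr0 mul0r scale0r subr0.
Qed.

(** The first three basis vectors are orthogonal to [(f, 1)], because their
    vertices lie on the face of [f]; they are fixed, and only [basis4] moves. *)
Lemma lattice_cap_reflection W : lattice W -> lattice (cap_reflection f W).
Proof.
have yff : (1 + y) * dot f f = 3 - x.
  by rewrite xE yE; have := weight_v (frame_dual F); lra.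
have ff1 : dot f f - 1 != 0 by rewrite subr_eq0 gt_eqF // (frame_ff F).
have dt a b c : dot (a *: v + b *: e + c *: f) f = a + b + c * dot f f.
  by rewrite !dotE !(gram F) !mulr1.
apply: lattice_stable; first exact: cap_reflection_lin.
- rewrite cap_reflection_fix ?dt; last by ring.
  by apply: (@lattice_comb 1 0 0 0) => //; split; ring.
- rewrite cap_reflection_fix ?dt; last by ring.
  by apply: (@lattice_comb 0 1 0 0) => //; split; ring.
- rewrite cap_reflection_fix ?dt; last by rewrite yff; ring.
  by apply: (@lattice_comb 0 0 1 0) => //; split; ring.
have -> : cap_reflection f basis4 = (4 * (1 + y)) *: comb 0 0 1 1 + basis4.
  rewrite /cap_reflection addrC -scaleNr; congr (_ *: _ + _); last first.
    by rewrite /comb !scale0r !add0r scale1r.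
  rewrite /basis4 dt -mulNr; apply: (mulIf ff1); rewrite divfK //=.
  have -> : (1 + y) * (x + y - 1) * dot f f = (x + y - 1) * (3 - x).
    by rewrite -yff; ring.
  have -> : 4 * (1 + y) * (dot f f - 1) = 4 * (3 - x) - 4 * (1 + y).
    by rewrite -yff; ring.
  by ring.
rewrite comb_lin; apply: (@lattice_comb 2 (2 * (1 + y - x)) (2 * (1 + y + x)) (- 1)).
all: in_subring.
by split; ring.
Qed.

Lemma lattice_vertex u : vertex_orbit v e f u -> lattice (u, 1).
Proof.
case=> h Gh <-; elim: Gh => [|n g Nn _ IH] /=; last first.
  by have := lattice_reflection Nn IH.
have -> : (v, 1) = comb 1 0 0 1 by rewrite /comb scale1r !scale0r !addr0.
by apply: (@lattice_comb 1 0 0 0) => //; split; ring.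
Qed.

(** For the other faces, the reflection is a conjugate of the one for [f]. *)
Lemma lattice_face g W : vertex_orbit f e v g -> lattice W ->
  lattice (cap_reflection g W).
Proof.
case=> h; rewrite -(normals_dual v e f) => Gh <-.
elim: Gh W => [|n k Nn _ IH] W lW; first exact: lattice_cap_reflection.
rewrite -[W](lift_reflectionK n) -lift_cap_reflection.
by apply: lattice_reflection => //; apply: IH; exact: lattice_reflection.
Qed.

(** * The quadratic relation between the bends *)

Section Functional.
Variables (z : 'rV[R]_3) (s : R) (zs : dot z z = s ^+ 2).

Definition value (W : lvec) : R := dot z W.1 - s * W.2.

Lemma value_lin a U W : value (a *: U + W) = a * value U + value W.
Proof. by rewrite /value /= !dotE /GRing.scale /=; ring. Qed.

Lemma value_lattice W : Z (value basis1) -> Z (value basis2) -> Z (value basis3) ->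
  Z (value basis4) -> lattice W -> Z (value W).
Proof.
move=> h1 h2 h3 h4 [c1 [c2 [c3 [c4 [k1 k2 k3 k4 ->]]]]].
rewrite -[c4 *: basis4]addr0 !value_lin.
have -> : value 0 = 0 by rewrite /value /= dot0r mulr0 subr0.
by in_subring.
Qed.

Lemma value_comb a b c t :
  value (comb a b c t) = a * dot z v + b * dot z e + c * dot z f - s * t.
Proof. by rewrite /value /comb /= !dotE. Qed.

(** Parseval in the orthogonal basis [e], [v - e], [f - e]. *)
Lemma frame_parseval : dot z z = dot z e ^+ 2
  + (dot z v - dot z e) ^+ 2 / (dot v v - 1)
  + (dot z f - dot z e) ^+ 2 / (dot f f - 1).
Proof.
have l0 : dot v v - 1 != 0 by rewrite subr_eq0 gt_eqF // (frame_vv F).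
have k0 : dot f f - 1 != 0 by rewrite subr_eq0 gt_eqF // (frame_ff F).
have zE : z = dot z e *: e + ((dot z v - dot z e) / (dot v v - 1)) *: (v - e)
    + ((dot z f - dot z e) / (dot f f - 1)) *: (f - e).
  apply/eqP; rewrite -subr_eq0; apply/eqP.
  by apply: (frame_ext F); rewrite !dotE !(gram F); field; rewrite l0 k0.
by rewrite {2}zE !dotE; field; rewrite l0 k0.
Qed.

Let null_form : s ^+ 2 - (dot z e ^+ 2
  + (dot z v - dot z e) ^+ 2 / (dot v v - 1)
  + (dot z f - dot z e) ^+ 2 / (dot f f - 1)) = 0.
Proof. by rewrite -frame_parseval zs subrr. Qed.

(** The functional [value] is the Lorentz form with the light-like vector
    [(z, s)]. The component of that vector along [(f, 1)] is determined up to sign by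
    its components on [basis1], [basis2], [basis3], which span the orthogonal
    complement; this is why the value at [basis4] satisfies a quadratic equation
    with this discriminant. *)
Lemma last_value_sqr :
  4 * ((1 + y) * (value basis1 * value basis2 + value basis2 * value basis3
                  + value basis3 * value basis1
                  - x * value basis2 ^+ 2))
  = (value basis4 - (value basis1 + (1 + y - x) * value basis2
                     + (1 + y + x) * value basis3)) ^+ 2.
Proof.
have l0 : dot v v - 1 != 0 by rewrite subr_eq0 gt_eqF // (frame_vv F).
have k0 : dot f f - 1 != 0 by rewrite subr_eq0 gt_eqF // (frame_ff F).
have S0 : dot v v * dot f f - 1 != 0 by rewrite gt_eqF // (frame_den F).
apply: subr0_eq; rewrite -[RHS](mulr0 (4 * (1 + y) * (2 - x - y))) -null_form.
rewrite !value_comb xE yE /weight [dot f f * _]mulrC.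
by field; rewrite l0 k0 S0.
Qed.

(** The same relation along the reversed path, which another flag describes. *)
Lemma first_value_sqr :
  4 * ((1 + y) * (value basis2 * value basis3 + value basis3 * value basis4
                  + value basis4 * value basis2
                  - x * value basis3 ^+ 2))
  = (value basis1 - (value basis4 + (1 + y - x) * value basis3
                     + (1 + y + x) * value basis2)) ^+ 2.
Proof.
have l0 : dot v v - 1 != 0 by rewrite subr_eq0 gt_eqF // (frame_vv F).
have k0 : dot f f - 1 != 0 by rewrite subr_eq0 gt_eqF // (frame_ff F).
have S0 : dot v v * dot f f - 1 != 0 by rewrite gt_eqF // (frame_den F).
apply: subr0_eq; rewrite -[RHS](mulr0 (4 * (1 + y) * (2 - x - y))) -null_form.
rewrite !value_comb xE yE /weight [dot f f * _]mulrC.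
by field; rewrite l0 k0 S0.
Qed.

(** The factor [4] is what makes [a] integral: [a] is [b] plus or minus twice the
    square root of [D]. *)
Lemma in_subring_of_sqrt D a b : 4 * D = (a - b) ^+ 2 ->
  Z b -> Z (Num.sqrt D) -> Z a.
Proof.
move=> DE Zb; have -> : D = ((a - b) / 2) ^+ 2.
  by rewrite expr_div_n -DE; field.
rewrite sqrtr_sqr => Zs.
have [h|h] := leP 0 ((a - b) / 2).
  rewrite ger0_norm // in Zs; have -> : a = b + 2 * ((a - b) / 2) by field.
  by in_subring.
rewrite ltr0_norm // in Zs; have -> : a = b - 2 * (- ((a - b) / 2)) by field.
by apply: ZB => //; apply: ZM.
Qed.

End Functional.

End Lattice.

(** * The packing *)

Section Packings.
Variable R : realType.
Local Notation lvec := ('rV[R]_3 * R^o)%type.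
Local Notation pvec := ('rV[R]_2 * R^o * R^o)%type.

Lemma int_adjoin_subring (a b : R) : subring (int_adjoin a b).
Proof.
split=> [S [S1 _ _] _ _ //|c d hc hd S Sr Sa Sb|c d hc hd S Sr Sa Sb].
  have [_ SB _] := Sr; by apply: SB; [exact: hc|exact: hd].
have [_ _ SM] := Sr; by apply: SM; [exact: hc|exact: hd].
Qed.

Lemma int_adjoinl (a b : R) : int_adjoin a b a. Proof. by move=> S _. Qed.
Lemma int_adjoinr (a b : R) : int_adjoin a b b. Proof. by move=> S _. Qed.

Variables (P : set 'rV[R]_3) (v e f : 'rV[R]_3).
Hypotheses (D : dual_pair v e f P (polar P)) (Pv : vertex P v).
Variables (Z : set R) (Zring : subring Z) (x y : R).
Hypotheses (xE : x = 4 * weight v f - 1) (yE : y = 4 * weight f v - 1).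
Hypotheses (Zx : Z x) (Zy : Z y).
Variable M : pvec -> pvec.
Hypotheses (Mlin : forall a U V, M (a *: U + V) = a *: M U + M V)
  (Miso : forall U V, pairing (M U) (M V) = pairing U V).
Variable mu : extended_plane R -> extended_plane R.
Hypothesis Mact : forall W, mu @` region_of W = region_of (M W).

Let F := pair_frame D.

(** Inversive coordinates of the circle that represents [W] once the Moebius
    transformation, acting by [M], has been applied. *)
Definition chart (W : lvec) : pvec := M (cap_vec W.1 W.2).

Lemma chart_lin a U W : chart (a *: U + W) = a *: chart U + chart W.
Proof. by rewrite /chart /= -Mlin -cap_vec_lin. Qed.

Lemma pairing_chart U W : pairing (chart U) (chart W) = 2 * lor U W.
Proof. by rewrite /chart Miso pairing_cap. Qed.

Lemma preflection_chart g W : 1 < dot g g ->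
  preflection ((Num.sqrt (dot g g - 1))^-1 *: chart (g, 1)) (chart W) =
  chart (cap_reflection g W).
Proof.
move=> gg; have gg0 : 0 < dot g g - 1 by rewrite subr_gt0.
rewrite /preflection pairingZr pairing_chart scalerA mulrAC -expr2 exprVn.
rewrite sqr_sqrtr ?ltW //.
have -> : cap_reflection g W =
    (- (2 * (dot W.1 g - W.2) / (dot g g - 1))) *: (g, 1) + W.
  by rewrite /cap_reflection addrC scaleNr.
rewrite chart_lin addrC -scaleNr; congr (_ *: _ + _); rewrite /lor /=; field.
by rewrite gt_eqF.
Qed.

Lemma circle_vec_chart C u : 1 < dot u u ->
  region C = mu @` stereographic_circle u ->
  circle_vec C = (Num.sqrt (dot u u - 1))^-1 *: chart (u, 1).
Proof.
move=> uu; have uu0 : 0 < dot u u - 1 by rewrite subr_gt0.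
have s0 : 0 < (Num.sqrt (dot u u - 1))^-1 by rewrite invr_gt0 sqrtr_gt0.
rewrite regionE stereographic_circleE Mact => h; apply: region_of_inj.
- exact: circle_vec_unit.
- rewrite pairingZl pairingZr pairing_chart mulrA -expr2 exprVn sqr_sqrtr ?ltW //.
  by rewrite /lor /=; field; rewrite gt_eqF.
- by rewrite h region_of_scale.
Qed.

Lemma orbit_gt1 g : vertex_orbit f e v g -> 1 < dot g g.
Proof. by move=> /vertex_orbit_norm ->; exact: frame_ff F. Qed.

(** In the chart, each inversion that generates the group of the packing is the
    reflection along [(g, 1)] for some [g] in the orbit of [f], since the vertices of
    the polar are exposed points. *)
Lemma packing_lattice G W :
  inversion_group (arrangement mu (polar P)) G -> lattice Z v e f x y W ->
  exists W', [/\ lattice Z v e f x y W', lor W' W' = lor W W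
    & G @` region_of (chart W) = region_of (chart W')].
Proof.
elim=> [|C h [g polg gC] _ IH] lW; first by exists W; rewrite image_id.
have [W' [lW' W'W' hW']] := IH lW.
have Og : vertex_orbit f e v g by case: polg => fg _; exact: exposed_in_orbit D fg.
have g1 := orbit_gt1 Og; have CE := circle_vec_chart g1 (esym gC).
exists (cap_reflection g W'); split.
- exact: (lattice_face Zring F xE yE Zx Zy Og lW').
- by rewrite cap_reflection_lor // gt_eqF.
- by rewrite -preflection_chart // -CE -inversion_region_of -hW' image_comp.
Qed.

End Packings.

Theorem corollary4 (R : realType) (p q : nat) (P0 : set 'rV[R]_3)
    (hP0 : canonical_platonic_solid p q P0)
    (mu : extended_plane R -> extended_plane R) (hmu : moebius mu)
    (b : seq R) (hb : fundamental_bend_vector mu P0 b)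
    (b1 b2 b3 : R) (hb123 : infix [:: b1; b2; b3] b)
    (Delta : R)
    (hDelta : Delta =
      (1 + omega R q) * (b1 * b2 + b2 * b3 + b3 * b1 - omega R p * b2 ^+ 2))
    (hb1 : int_adjoin (omega R p) (omega R q) b1)
    (hb2 : int_adjoin (omega R p) (omega R q) b2)
    (hb3 : int_adjoin (omega R p) (omega R q) b3)
    (hsqrt : int_adjoin (omega R p) (omega R q) (Num.sqrt Delta)) :
  integral_arrangement (int_adjoin (omega R p) (omega R q))
    (crystallographic_packing mu P0).
Proof.
case: hP0 => [[polyP dimP _ cardp cardq] tang].
case: hb => v1 [v2 [v3 [v4 [C1 [C2 [C3 [C4 [basis rC1 rC2 rC3 [rC4 bE]]]]]]]]].
case: basis => fl [r1 [r2 [r3 [flP R1 R2 R3 [fl0 v2D v3D v4D]]]]].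
have [e [f [D r1E r2E r3E dimF]]] :=
  dual_pair_of_flag polyP dimP tang flP R1 R2 R3 fl0.
have Pv1 : vertex P0 v1.
  by case: flP => _ fldim _; rewrite /vertex -fl0; exact: fldim ord0.
have F := pair_frame D.
set x := omega R p in hDelta hb1 hb2 hb3 hsqrt *.
set y := omega R q in hDelta hb1 hb2 hb3 hsqrt *.
have xE : x = 4 * weight v1 f - 1 by exact: (omega_face D Pv1 (cardp _ dimF)).
have yE : y = 4 * weight f v1 - 1 by exact: (omega_vertex D dimP dimF (cardq _ Pv1)).
set Z := int_adjoin x y in hb1 hb2 hb3 hsqrt *.
have Zring : subring Z by exact: int_adjoin_subring.
have Zx : Z x by exact: int_adjoinl.
have Zy : Z y by exact: int_adjoinr.
have [M [Mlin Miso Mact Madj]] := moebius_isometry hmu.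
have vv := frame_vv F.
pose k := (Num.sqrt (dot v1 v1 - 1))^-1.
(* Up to sign, the bend is the pairing with the point at infinity; the pullback
   [N'] of the latter to Minkowski space is light-like. *)
have [z [s [zs valueE]]] : exists z s, dot z z = s ^+ 2 /\
    forall W, k * (chart M W).1.2 = value z s W.
  have [N' NN NE] := Madj (point_vec None).
  pose w := space N'.1.1 ((N'.2 - N'.1.2) / 2); pose t := (N'.1.2 + N'.2) / 2.
  have N'E : N' = cap_vec w t.
    rewrite /cap_vec /w /t planar_space space_max; case: N' {NN NE w t} => [[a b'] c] /=.
    by congr (_, _, _); field.
  exists ((- 2 * k) *: w), (- 2 * k * t); split.
    move: NN; rewrite N'E pairing_cap /pairing /= dot0l !mulr0 !mul0r !subr0 => ww.
    have -> : dot ((- 2 * k) *: w) ((- 2 * k) *: w) = (- 2 * k) ^+ 2 * dot w w.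
      by rewrite !dotE; ring.
    have -> : dot w w = t * t by lra.
    by ring.
  move=> W; have -> : (chart M W).1.2 = - pairing (chart M W) (point_vec None).
    by rewrite /pairing /= dot0r; ring.
  by rewrite /chart NE N'E pairing_cap /value !dotE (dotC w); ring.
have bendE C u : vertex_orbit v1 e f u -> region C = mu @` stereographic_circle u ->
    bend C = value z s (u, 1).
  move=> Ou rC; have uu := vertex_orbit_norm Ou.
  have u1 : 1 < dot u u by rewrite uu.
  by rewrite bend_vec (circle_vec_chart Miso Mact u1 rC) -valueE /k -uu.
have V1E : (v1, 1) = basis1 v1 e f.
  by rewrite /basis1 /comb scale1r !scale0r !addr0.
have basis2E' : (v2, 1) = basis2 v1 e f.
  by rewrite (basis2E F) -V1E v2D r1E.
have basis3E' : (v3, 1) = basis3 v1 e f x y.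
  by rewrite (basis3E F xE yE) -basis2E' v3D r1E r2E.
have basis4E' : (v4, 1) = basis4 v1 e f x y.
  by rewrite (basis4E F xE yE) -basis3E' v4D r1E r2E r3E.
have O1 : vertex_orbit v1 e f v1 by exists id => //; exact: reflection_group_id.
have N1 : normals v1 e f (v1 - e) by constructor 1.
have N2 : normals v1 e f (mirror v1 e f) by constructor 2.
have N3 : normals v1 e f (f - e) by constructor 3.
have O2 : vertex_orbit v1 e f v2.
  by rewrite v2D r1E; apply: vertex_orbit_stable.
have O3 : vertex_orbit v1 e f v3.
  by rewrite v3D r1E r2E; do 2!apply: vertex_orbit_stable => //.
have O4 : vertex_orbit v1 e f v4.
  by rewrite v4D r1E r2E r3E; do 3!apply: vertex_orbit_stable => //.
have B1 := bendE _ _ O1 rC1; rewrite V1E in B1.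
have B2 := bendE _ _ O2 rC2; rewrite basis2E' in B2.
have B3 := bendE _ _ O3 rC3; rewrite basis3E' in B3.
have B4 := bendE _ _ O4 rC4; rewrite basis4E' in B4.
have ZD a c : Z a -> Z c -> Z (a + c) by exact: subringD.
have [Z1 ZB ZM] := Zring.
have [ZV1 ZV2 ZV3 ZV4] : [/\ Z (value z s (basis1 v1 e f)), Z (value z s (basis2 v1 e f)),
    Z (value z s (basis3 v1 e f x y)) & Z (value z s (basis4 v1 e f x y))].
  (* The bend that is not given is the last or the first one. *)
  move: hb123 hDelta hb1 hb2 hb3; rewrite bE B1 B2 B3 B4 /=.
  rewrite !andbT !andbF !orbF => /orP[] /and3P[/eqP-> /eqP-> /eqP->]
    DeltaE h1 h2 h3; split=> //.
    apply: (in_subring_of_sqrt Zring _ _ hsqrt).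
      by rewrite DeltaE; exact: (last_value_sqr F xE yE zs).
    by repeat first [assumption | apply ZB | apply ZD | apply ZM].
  apply: (in_subring_of_sqrt Zring _ _ hsqrt).
    by rewrite DeltaE; exact: (first_value_sqr F xE yE zs).
  by repeat first [assumption | apply ZB | apply ZD | apply ZM].
move=> _ [G [_ [GG [u Pu <-] ->]]].
have Ou : vertex_orbit v1 e f u by rewrite -(vertexE D Pv1).
have lu := lattice_vertex Zring F xE yE Zx Zy Ou.
have [W' [lW' W'W' GW']] := packing_lattice D Zring xE yE Zx Zy Mlin Miso Mact GG lu.
have l0 : 0 < dot v1 v1 - 1 by rewrite subr_gt0.
have k0 : 0 < k by rewrite invr_gt0 sqrtr_gt0.
have [C CE] : exists C, circle_vec C = k *: chart M W'.
  apply: circle_of_vec; rewrite pairingZl pairingZr (pairing_chart Miso) W'W'.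
  rewrite mulrA -expr2 exprVn sqr_sqrtr ?ltW // /lor /= (vertex_orbit_norm Ou).
  by field; rewrite gt_eqF.
exists C.
  by rewrite regionE CE region_of_scale // -GW' stereographic_circleE Mact.
rewrite bend_vec CE; have -> : (k *: chart M W').1.2 = k * (chart M W').1.2 by [].
by rewrite valueE; exact: (value_lattice Zring ZV1 ZV2 ZV3 ZV4 lW').
Qed.
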